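(* Let $K$ be a field, $P$ a finite poset, and $L=\mathcal{I}(P)$ the distributive lattice of poset ideals of $P$, and suppose $L$ is non-planar. Then \[ |P|-1\ \ge\ \operatorname{reg} R(L)\ \ge\ \max\{|Q| : Q\subseteq P \text{ is a set of pairwise incomparable join-irreducible elements of } L\}-1. \]
   Context: By Birkhoff's theorem, $P$ is identified with the subposet of join-irreducible elements of $L=\mathcal{I}(P)$. For a finite distributive lattice $L$, $K[L]$ is the polynomial ring over $K$ in the elements of $L$, $I_L$ is generated by $ab-(a\vee b)(a\wedge b)$ for all incomparable $a,b\in L$, $R(L)=K[L]/I_L$, and $\operatorname{reg} R(L)$ is its Castelnuovo–Mumford regularity as a graded $K[L]$-module. A planar distributive lattice is a finite sublattice $L$ of $\mathbb{N}^2$ (componentwise order) with $(0,0)\in L$ such that any two comparable elements are joined by a chain in $L$ along which the coordinate sum increases by exactly $1$ at each step; $L$ is non-planar if it is not isomorphic to such a lattice. *)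

(* Defs.v *)
From HB Require Import structures.
From mathcomp Require Import all_boot all_order all_algebra.
From mathcomp Require Import mpoly.
Set Implicit Arguments. Unset Strict Implicit. Unset Printing Implicit Defensive.
Import Order.TTheory GRing.Theory.

(* The finite poset P is a finPOrderType; L = I(P) is the set of its   *)
(* order ideals (down-closed subsets), ordered by inclusion, with      *)
(* join = union and meet = intersection.                               *)
Section Hibi.
Context {disp : Order.disp_t} (T : finPOrderType disp).

Definition is_poset_ideal (A : {set T}) : bool :=
  [forall x : T, forall y : T, ((y <= x)%O && (x \in A)) ==> (y \in A)].

Definition ideal := {A : {set T} | is_poset_ideal A}.

Definition antichain (Q : {set T}) : bool :=
  [forall x in Q, forall y in Q, (x != y) ==> ~~ (x >=< y)%O].

Definition le2 (u v : nat * nat) : bool := (u.1 <= v.1) && (u.2 <= v.2).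
Definition max2 (u v : nat * nat) : nat * nat := (maxn u.1 v.1, maxn u.2 v.2).
Definition min2 (u v : nat * nat) : nat * nat := (minn u.1 v.1, minn u.2 v.2).
Definition cover2 (u v : nat * nat) : bool :=
  le2 u v && (v.1 + v.2 == (u.1 + u.2).+1).

Definition planar_set (s : seq (nat * nat)) : Prop :=
  [/\ (0, 0) \in s,
      {in s &, forall u v, max2 u v \in s /\ min2 u v \in s} &
      {in s &, forall u v, le2 u v ->
          exists c : seq (nat * nat),
            [/\ path cover2 u c, all (mem s) c & last u c = v]}].

(* L = I(P) is planar if it is (order-, hence lattice-) isomorphic to such a lattice *)
Definition planar_lattice : Prop :=
  exists (s : seq (nat * nat)) (f : ideal -> nat * nat),
    [/\ planar_set s, injective f,
        (forall a, f a \in s), (forall u, u \in s -> exists a, f a = u) &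
        (forall a b : ideal, le2 (f a) (f b) = (val a \subset val b))].

Local Open Scope ring_scope.
Context (K : fieldType).

Local Notation n := #|{: ideal}|.
Local Notation S := {mpoly K[n]}.

(* the variable of K[L] attached to a subset A of P which is an ideal
   (0 if A is not an ideal; only applied to ideals below) *)
Definition varL (A : {set T}) : S :=
  odflt (0 : S) (omap (fun a : ideal => ('X_(enum_rank a) : S)) (insub A)).

Definition hibi_gen (a b : ideal) : S :=
  varL (val a) * varL (val b) - varL (val a :|: val b) * varL (val a :&: val b).

Definition incomparable_ideals (a b : ideal) : bool :=
  ~~ (val a \subset val b) && ~~ (val b \subset val a).

Definition in_hibi_ideal (p : S) : Prop :=
  exists g : ideal * ideal -> S,
    p = \sum_(ab : ideal * ideal | incomparable_ideals ab.1 ab.2)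
          g ab * hibi_gen ab.1 ab.2.

(* ---- Minimal graded free resolutions of R(L) over K[L] ----
   F_i = (+)_{k < b i} S(-d i k), with F_0 = S (b 0 = 1, d 0 = 0);
   the differential F_{i+1} -> F_i is v |-> v *m M i (row vectors),
   for i < len; F_i = 0 for i > len. *)
Record resolution := Resolution {
  res_len : nat;
  res_rank : nat -> nat;
  res_deg : forall i, 'I_(res_rank i) -> nat;
  res_map : forall i, 'M[S]_(res_rank i.+1, res_rank i)
}.

Arguments res_deg : clear implicits.
Arguments res_map : clear implicits.

Definition is_min_graded_free_resolution (F : resolution) : Prop :=
  let b := res_rank F in let d := res_deg F in let M := res_map F in
  let p := res_len F in
  [/\ b 0 = 1%N /\ (forall k, d 0 k = 0%N),
      (* graded, and minimal: every nonzero entry is homogeneous of positive degree *)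
      (forall i, (i < p)%N -> forall k l, M i k l != 0 ->
          (d i l < d i.+1 k)%N /\ M i k l \is (d i.+1 k - d i l)%N.-homog),
      (* cokernel of the first map is S / I_L *)
      (p = 0%N -> forall q : S, in_hibi_ideal q <-> q = 0) /\
      ((0 < p)%N -> forall q : S, in_hibi_ideal q <->
          exists w : 'rV[S]_(b 1%N), q = \sum_(k < b 0%N) (w *m M 0%N) ord0 k),
      (forall i, (i.+1 < p)%N -> forall v : 'rV[S]_(b i.+1),
          v *m M i = 0 <-> exists w : 'rV[S]_(b i.+2), v = w *m M i.+1) &
      (forall j, p = j.+1 -> forall v : 'rV[S]_(b j.+1), v *m M j = 0 -> v = 0)].

(* reg = max { j - i : beta_{i,j} <> 0 } read off a minimal resolution *)
Definition res_reg (F : resolution) : nat :=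
  \max_(i < (res_len F).+1) \max_(k < res_rank F i) (res_deg F i k - i)%N.

End Hibi.

(* Main.v *)
Require Import Defs.
From HB Require Import structures.
From mathcomp Require Import all_boot all_order all_algebra.
From mathcomp Require Import mpoly.
Set Implicit Arguments. Unset Strict Implicit. Unset Printing Implicit Defensive.
Import Order.TTheory GRing.Theory.

(* The Hibi ring R is the toric ring of the monomials t * \prod_(x in J) X_x.
   Let theta_i be the sum of the variables of the ideals of size i.  Over
   A = K[theta_0, ..., theta_|P|] the ring R is free, with one basis monomial
   for each linear extension w of P: the product of the variables of the ideals
   of w at its descents.  Its degree is the number of descents of w; let r be
   the largest such number.  The m variables of S which complete the theta_i to
   a coordinate system are then adjoined to A one at a time: if G resolves R and
   N lifts multiplication by the new variable Z to G, the mapping cone of Z - N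
   resolves R over the larger ring.  The result is a finite free resolution of R
   over S of length m, whose generators in homological degree i have degree at
   most i + r, and with a generator of degree m + r in homological degree m.
   Eliminating unit entries yields a minimal resolution.  Conversely, comparison
   up to homotopy shows that a minimal resolution has no generator of degree
   greater than i + r in homological degree i, and that the top generator
   survives in it; hence reg R = r.  Finally r <= |P| - 1, and listing an
   antichain Q by decreasing labels gives a linear extension with at least
   |Q| - 1 descents. *)

(** Freeness rests on P-partitions. An exponent vector of a monomial of R is an order-reversing
    function on P bounded by the exponent of t. Sorting P by decreasing value, ties by increasing
    label, singles out one linear extension w, so every monomial of R is the image of exactly one
    product of variables from the flag of w that includes those at the descents of w. The theta_i do
    not respect this bijection: a monomial in the theta_i times the basis monomial of w also
    produces terms that leave the flag. A potential on exponent vectors makes the expansion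
    triangular. With the sizes of the ideals prescribed, the sum of squared exponents is largest on
    chains of ideals; among chains through the descent ideals of w, a weight that favours small
    labels is largest on the flag of w. Leading terms then give independence over A, and induction
    on the potential gives generation. The regularity can be read off a non-minimal resolution
    because its extremal generator sits in a corner: nothing lies in a higher homological degree,
    and one step lower all degrees are strictly smaller, so no unit entry can touch it. *)

Local Open Scope ring_scope.

(** * Graded components *)

Section Degree.
Context (K : fieldType).

(* The homogeneous part of [s] that a coefficient must have so that a product
   with a form of degree [i] has degree [j]; it vanishes when [j < i]. *)
Definition part n (j i : nat) (s : {mpoly K[n]}) : {mpoly K[n]} :=
  if (i <= j)%N then pihomog mdeg (j - i) s else 0.

Lemma part0 n j i : part j i (0 : {mpoly K[n]}) = 0.
Proof. by rewrite /part raddf0 if_same. Qed.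

Lemma part_homog n j i (s : {mpoly K[n]}) : part j i s \is (j - i).-homog.
Proof. by rewrite /part; case: ifP => _; rewrite ?dhomog0 // pihomogP. Qed.

Lemma part_neq0 n j i (s : {mpoly K[n]}) : part j i s != 0 -> (i <= j)%N.
Proof. by rewrite /part; case: ifP => //; rewrite eqxx. Qed.

(** Lets an arbitrary preimage of a form be replaced by a homogeneous one. The target has its own
    grading [mf] because on the toric side the degree is the exponent of t, not the total degree. *)
Lemma pihomog_morph n k (mf : measure k)
    (f : {rmorphism {mpoly K[n]} -> {mpoly K[k]}}) i j s (e : {mpoly K[k]}) :
    (forall d p, p \is d.-homog -> f p \is d.-homog for mf) ->
    e \is i.-homog for mf ->
  pihomog mf j (f s * e) = f (part j i s) * e.
Proof.
move=> fh eh; rewrite {1}(pihomog_partitionE (leqnn (msize s))).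
rewrite rmorph_sum mulr_suml raddf_sum /=.
have hd d : f (pihomog mdeg d s) * e \is (d + i)%N.-homog for mf.
  by apply: dhomogM => //; apply/fh/pihomogP.
rewrite (eq_bigr (fun d : 'I_(msize s) => if (d + i)%N == j then
    f (pihomog mdeg d s) * e else 0)); last first.
  move=> d _; case: eqP => [<-|/eqP ne]; first by rewrite pihomog_dE.
  by rewrite (pihomog_ne0 ne).
rewrite -big_mkcond /= /part; case: leqP => ij; last first.
  rewrite rmorph0 mul0r big1 // => d /eqP dj.
  by move: ij; rewrite -dj ltnNge leq_addl.
case: (ltnP (j - i) (msize s)) => h.
  rewrite (big_pred1 (Ordinal h)) // => d /=.
  by rewrite -val_eqE /= -[d == _ :> nat](eqn_add2r i) subnK.
rewrite big_pred0 => [|d]; last first.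
  apply/negP => /eqP dj; move: (ltn_ord d) h.
  by rewrite -dj addnK ltnNge => /negbTE ->.
rewrite [pihomog _ _ _]pihomogE big_seq_cond big1 ?rmorph0 ?mul0r // => m /andP [ms /eqP mh].
by move: (msize_mdeg_lt ms); rewrite mh ltnNge h.
Qed.

Lemma pihomog_mulr n i j (s e : {mpoly K[n]}) :
  e \is i.-homog -> pihomog mdeg j (s * e) = part j i s * e.
Proof. by move=> eh; rewrite (@pihomog_morph n n mdeg idfun i j s e). Qed.

Lemma part_mulr n (a b j : nat) (s e : {mpoly K[n]}) :
    (b <= a)%N -> e \is (a - b).-homog ->
  part j b (s * e) = part j a s * e.
Proof.
move=> ba eh; rewrite [in LHS]/part; case: leqP => bj; last first.
  by rewrite /part leqNgt (leq_trans bj ba) /= mul0r.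
rewrite (pihomog_mulr _ _ eh) /part leq_subLR subnKC // subnBA //.
by rewrite (subnK bj).
Qed.

Lemma part_id n (j i : nat) (s : {mpoly K[n]}) :
  (i <= j)%N -> s \is (j - i).-homog -> part j i s = s.
Proof. by move=> ij sh; rewrite /part ij pihomog_dE. Qed.

Lemma mcoeff0_homog n d (s : {mpoly K[n]}) :
  s \is d.-homog -> s@_0%MM != 0 -> d = 0%N.
Proof.
move=> sh; rewrite -mcoeff_msupp => ms.
by rewrite -(dhomog_mf sh ms) mf0.
Qed.

Lemma dhomog0C n (s : {mpoly K[n]}) : s \is 0.-homog -> s = (s@_0%MM)%:MP.
Proof.
move=> sh; apply/mpolyP => m; rewrite mcoeffC.
have [->|m0] := eqVneq m 0%MM; first by rewrite mulr1.
by rewrite mulr0 (dhomog_nemf_coeff sh) // mdeg_eq0.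
Qed.

Lemma rmorph_homog n k (mf : measure k)
    (f : {rmorphism {mpoly K[n]} -> {mpoly K[k]}}) :
    (forall c, f c%:MP \is 0.-homog for mf) ->
    (forall i, f 'X_i \is 1.-homog for mf) ->
  forall d p, p \is d.-homog -> f p \is d.-homog for mf.
Proof.
move=> fC fX d p /dhomogP ph; rewrite [p]mpolyE rmorph_sum.
rewrite big_seq; apply: rpred_sum => m mp; rewrite -mul_mpolyC rmorphM -[d]add0n.
apply: dhomogM => //; rewrite -(ph _ mp : mdeg m = d) mpolyXE_id rmorph_prod mdegE.
elim/big_rec2: _ => [|i d' y _ IH]; first by rewrite dhomog1.
by apply: dhomogM IH; rewrite rmorphXn; have := dhomogMn (m i) (fX i); rewrite mul1n.
Qed.

End Degree.

(** * Based complexes *)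

Section BasedComplex.
Context (K : fieldType).

(* A complex of graded free modules with bases: all homological degrees share the
   finite type [gen], a vector is a function on [gen], and [df a b] is the
   coefficient of [b] in the boundary of [a].  The augmentation [aug] takes values
   in a polynomial ring containing the resolved module, see [is_res]. *)
Record bcx (n k : nat) := Bcx {
  gen : finType;
  hd : gen -> nat;
  dg : gen -> nat;
  df : gen -> gen -> {mpoly K[n]};
  aug : gen -> {mpoly K[k]}
}.

Arguments hd {n k} b _.
Arguments dg {n k} b _.
Arguments df {n k} b _ _.
Arguments aug {n k} b _.

Context (k : nat) (mf : measure k).
Local Notation U := {mpoly K[k]}.

Definition bd n (C : bcx n k) (v : gen C -> {mpoly K[n]}) (c : gen C) :=
  \sum_b v b * df C b c.

Definition av n (f : {mpoly K[n]} -> U) (C : bcx n k) (v : gen C -> {mpoly K[n]}) : U :=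
  \sum_b f (v b) * aug C b.

(* The last two fields say that the kernel of the augmented differential, on vectors
   of mixed homological degree, is its image, and that the augmentation is onto [R]. *)
Record is_res n (f : {mpoly K[n]} -> U) (R : U -> Prop) (C : bcx n k) : Prop := IsRes {
  df_hd : forall a b, df C a b != 0 -> hd C a = (hd C b).+1;
  df_homog : forall a b, df C a b != 0 ->
    (dg C b <= dg C a)%N /\ df C a b \is (dg C a - dg C b).-homog;
  aug_hd : forall a, aug C a != 0 -> hd C a = 0%N;
  aug_homog : forall a, aug C a \is (dg C a).-homog for mf;
  df_df : forall a c, bd (df C a) c = 0;
  df_aug : forall a, av f (df C a) = 0;
  res_exact : forall v : gen C -> {mpoly K[n]}, (forall c, bd v c = 0) ->
    av f v = 0 -> exists w : gen C -> {mpoly K[n]}, forall c, v c = bd w c;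
  res_img : forall u, R u <-> exists v : gen C -> {mpoly K[n]}, u = av f v
}.

(** Bihomogeneous vectors: homological degree [i], internal degree [j]. The bound [dg C b <= j]
    guards against the truncated subtraction in [j - dg C b]. *)
Definition hvec n (C : bcx n k) (i j : nat) (v : gen C -> {mpoly K[n]}) : Prop :=
  forall b, v b != 0 ->
    [/\ hd C b = i, (dg C b <= j)%N & v b \is (j - dg C b).-homog].

Section Lift.
Context (n : nat) (f : {rmorphism {mpoly K[n]} -> U}) (R : U -> Prop).
Hypothesis fh : forall d p, p \is d.-homog -> f p \is d.-homog for mf.
Local Notation S := {mpoly K[n]}.

Lemma hvec_sum C i j I (r : seq I) (F : I -> gen C -> S) :
  (forall x, hvec i j (F x)) -> hvec i j (fun b => \sum_(x <- r) F x b).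
Proof.
move=> Fh b; elim: r => [|x r IH]; first by rewrite big_nil eqxx.
rewrite big_cons; have [->|x0] := eqVneq (F x b) 0; first by rewrite add0r.
have [h1 h2 h3] := Fh _ _ x0; move=> _; split=> //.
apply: dhomogD => //; case: (eqVneq (\sum_(j <- r) F j b) 0) => [->|].
  exact: dhomog0.
by case/IH.
Qed.

Lemma hvecD C i j (v w : gen C -> S) :
  hvec i j v -> hvec i j w -> hvec i j (fun b => v b + w b).
Proof.
move=> vh wh b; have [->|v0] := eqVneq (v b) 0; first by rewrite add0r => /wh.
have [->|w0] := eqVneq (w b) 0; first by rewrite addr0 => /vh.
by case: (vh b v0) (wh b w0) => ? ? ? [? ? ?] _; split=> //; apply: dhomogD.
Qed.

Lemma hvecN C i j (v : gen C -> S) : hvec i j v -> hvec i j (fun b => - v b).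
Proof.
move=> vh b; rewrite oppr_eq0 => v0; case: (vh b v0) => ? ? ?.
by split=> //; rewrite dhomogN.
Qed.

Lemma hvecZ C i j e (s : S) (v : gen C -> S) :
    (s != 0 -> (e <= j)%N /\ s \is (j - e).-homog) ->
    (s != 0 -> hvec i e v) -> hvec i j (fun b => s * v b).
Proof.
move=> sh vh b; rewrite mulf_eq0 negb_or => /andP [s0 v0].
have [ej shh] := sh s0; have [h1 h2 h3] := vh s0 _ v0.
split=> //; first exact: leq_trans h2 ej.
have -> : (j - dg C b = (j - e) + (e - dg C b))%N by rewrite addnBA // subnK.
exact: dhomogM.
Qed.

Lemma bd_linear C (w : gen C -> S) I (r : seq I) (F : I -> gen C -> S) (s : I -> S) c :
  (forall b, w b = \sum_(x <- r) s x * F x b) ->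
  bd w c = \sum_(x <- r) s x * bd (F x) c.
Proof.
move=> wE; rewrite /bd (eq_bigr (fun b => \sum_(x <- r) s x * F x b * df C b c)).
  by rewrite exchange_big /=; apply: eq_bigr => x _; rewrite mulr_sumr;
    apply: eq_bigr => b _; rewrite mulrA.
by move=> b _; rewrite wE mulr_suml.
Qed.

Lemma av_linear C (w : gen C -> S) I (r : seq I) (F : I -> gen C -> S) (s : I -> S) :
  (forall b, w b = \sum_(x <- r) s x * F x b) ->
  av f w = \sum_(x <- r) f (s x) * av f (F x).
Proof.
move=> wE; rewrite /av (eq_bigr (fun b => \sum_(x <- r) f (s x) * (f (F x b) * aug C b))).
  by rewrite exchange_big /=; apply: eq_bigr => x _; rewrite mulr_sumr.
move=> b _; rewrite wE rmorph_sum mulr_suml; apply: eq_bigr => x _.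
by rewrite rmorphM mulrA.
Qed.

Lemma bdD C (v w : gen C -> S) c : bd (fun b => v b + w b) c = bd v c + bd w c.
Proof. by rewrite /bd -big_split; apply: eq_bigr => b _; rewrite mulrDl. Qed.

Lemma bdN C (v : gen C -> S) c : bd (fun b => - v b) c = - bd v c.
Proof. by rewrite /bd -sumrN; apply: eq_bigr => b _; rewrite mulNr. Qed.

Lemma avD C (v w : gen C -> S) : av f (fun b => v b + w b) = av f v + av f w.
Proof. by rewrite /av -big_split; apply: eq_bigr => b _; rewrite rmorphD mulrDl. Qed.

Lemma avN C (v : gen C -> S) : av f (fun b => - v b) = - av f v.
Proof. by rewrite /av -sumrN; apply: eq_bigr => b _; rewrite rmorphN mulNr. Qed.

Lemma bd_bd C (v : gen C -> S) c :
  (forall a c, bd (df C a) c = 0) -> bd (bd v) c = 0.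
Proof.
move=> dd; rewrite (@bd_linear _ _ _ (index_enum _) (df C) v) //.
by rewrite big1 // => x _; rewrite dd mulr0.
Qed.

Lemma av_bd C (v : gen C -> S) :
  (forall a, av f (df C a) = 0) -> av f (bd v) = 0.
Proof.
move=> da; rewrite (@av_linear _ _ _ (index_enum _) (df C) v) //.
by rewrite big1 // => x _; rewrite da mulr0.
Qed.

(** [res_exact] gives a preimage of mixed degrees. Keeping only its coordinates in homological
    degree [i.+1], and in each the component of the right degree, does not change the boundary,
    since the entries of the differential are homogeneous. *)
Lemma exact_hvec C i j v : is_res f R C -> hvec i j v ->
  (forall c, bd v c = 0) -> av f v = 0 ->
  exists2 w : gen C -> S, hvec i.+1 j w & forall c, v c = bd w c.
Proof.
move=> Cr vh vd va; have [w0 w0E] := res_exact Cr vd va.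
exists (fun b => if hd C b == i.+1 then part j (dg C b) (w0 b) else 0).
  move=> b /=; case: (hd C b =P _) => [hb|]; last by rewrite eqxx.
  by move=> /part_neq0 jb; split=> //; apply: part_homog.
move=> c; case: (eqVneq (hd C c) i) => [hc|hc]; last first.
  rewrite /bd big1 => [|b _]; first by apply/eqP; apply: contraNT hc => /vh [->].
  case: eqP => hb; last by rewrite mul0r.
  have [->|/(df_hd Cr)] := eqVneq (df C b c) 0; first by rewrite mulr0.
  by rewrite hb => -[E]; rewrite E eqxx in hc.
have -> : v c = part j (dg C c) (v c).
  have [->|/vh [_ h2 h3]] := eqVneq (v c) 0; first by rewrite part0.
  by rewrite part_id.
rewrite w0E /bd; transitivity (\sum_b part j (dg C c) (w0 b * df C b c)).
  rewrite /part; case: ifP => _; first by rewrite raddf_sum.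
  by rewrite big1.
apply: eq_bigr => b _; have [->|d0] := eqVneq (df C b c) 0.
  by rewrite !mulr0 part0.
have [h1 h2] := df_homog Cr d0.
by rewrite (df_hd Cr d0) hc eqxx (part_mulr _ _ h1 h2).
Qed.

Lemma img_hvec C j u : is_res f R C -> R u -> u \is j.-homog for mf ->
  exists2 w : gen C -> S, hvec 0 j w & u = av f w.
Proof.
move=> Cr /(res_img Cr) [v vE] uh.
exists (fun b => if hd C b == 0%N then part j (dg C b) (v b) else 0).
  move=> b /=; case: (hd C b =P _) => [hb|]; last by rewrite eqxx.
  by move=> /part_neq0 jb; split=> //; apply: part_homog.
rewrite -(pihomog_dE uh) vE /av raddf_sum /=; apply: eq_bigr => b _.
rewrite (pihomog_morph _ _ fh (aug_homog Cr b)).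
case: eqP => // /eqP hb; have [->|/(aug_hd Cr) h0] := eqVneq (aug C b) 0.
  by rewrite !mulr0.
by rewrite h0 in hb.
Qed.

Lemma av_hvec C i j v : is_res f R C -> @hvec n C i.+1 j v -> av f v = 0.
Proof.
move=> Cr vh; rewrite /av big1 // => b _.
have [->|/vh [hb _ _]] := eqVneq (v b) 0; first by rewrite rmorph0 mul0r.
have [->|/(aug_hd Cr)] := eqVneq (aug C b) 0; first by rewrite mulr0.
by rewrite hb.
Qed.

(* Chain maps and homotopies are both built along the homological degree. *)
Lemma hd_recursion (B : finType) (h : B -> nat) (T : Type) (t0 : T)
    (P : (B -> T) -> B -> Prop) :
    (forall b g g', g b = g' b -> (forall c, (h c < h b)%N -> g c = g' c) ->
       P g b -> P g' b) ->
    (forall b g, (forall c, (h c < h b)%N -> P g c) ->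
       exists t, P (fun c => if c == b then t else g c) b) ->
  exists g, forall b, P g b.
Proof.
move=> Ploc Pstep; suff H i : exists g, forall b, (h b < i)%N -> P g b.
  by have [g gP] := H (\max_b h b).+1; exists g => b; apply/gP; rewrite ltnS leq_bigmax.
elim: i => [|i [g gP]]; first by exists (fun=> t0).
have /fin_all_exists [t tP] b : exists t, h b = i ->
    P (fun c => if c == b then t else g c) b.
  have [hb|hb] := eqVneq (h b) i; last by exists t0 => /eqP; rewrite (negPf hb).
  have [|t tP] := Pstep b g; first by move=> c; rewrite hb; apply: gP.
  by exists t.
(* The whole layer of degree [i] is changed at once, although each [t b] was found by changing [g]
   at [b] alone: by [Ploc], [P] at [b] sees only the value at [b] and the lower layers. *)
exists (fun c => if h c == i then t c else g c) => b; rewrite ltnS leq_eqVlt.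
case/orP => [/eqP hb|hb].
  apply: Ploc (tP b hb) => [|c]; rewrite ?eqxx ?hb ?eqxx // => hc.
  by rewrite (ltn_eqF hc); case: eqP hc => // ->; rewrite hb ltnn.
apply: Ploc (gP b hb) => [|c hc]; first by rewrite (ltn_eqF hb).
by rewrite (ltn_eqF (ltn_trans hc hb)).
Qed.

(** * Lifting and homotopy between two resolutions *)

Section Compare.
Context (C C' : bcx n k) (Cr : is_res f R C) (Cr' : is_res f R C').

(** Used with [u = 1], [s = 0] to compare resolutions, and with [u] the image of a linear form,
    [s = 1], to lift multiplication by it. On generators of homological degree 0 the value comes
    from surjectivity of the augmentation, above that from exactness applied to the lift of the
    boundary. *)
Lemma chain_lift (u : U) (s : nat) :
    u \is s.-homog for mf -> (forall x, R x -> R (u * x)) ->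
  exists g : gen C -> gen C' -> S, [/\
    forall b, hvec (hd C b) (dg C b + s) (g b),
    forall b c, bd (g b) c = \sum_a df C b a * g a c &
    forall b, av f (g b) = u * aug C b].
Proof.
move=> uh uR; pose P (g : gen C -> gen C' -> S) b := [/\
    hvec (hd C b) (dg C b + s) (g b),
    forall c, bd (g b) c = \sum_a df C b a * g a c &
    av f (g b) = u * aug C b].
suff [g gP] : exists g, forall b, P g b by exists g; split=> b; case: (gP b).
apply: (@hd_recursion _ (hd C) _ (fun=> 0)) => [b g g' gb glt [P1 P2 P3]|b g gP].
  split; rewrite -?gb // => c; rewrite P2; apply: eq_bigr => a _.
  by have [->|/(df_hd Cr) h] := eqVneq (df C b a) 0; rewrite ?mul0r // glt ?h.
have E t c : \sum_a df C b a * (if a == b then t else g a) c =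
             \sum_a df C b a * g a c.
  apply: eq_bigr => a _; case: eqP => // ->.
  have [->|/(df_hd Cr) /eqP] := eqVneq (df C b b) 0; first by rewrite !mul0r.
  by rewrite eqn_leq ltnn andbF.
suff [t [t1 t2 t3]] : exists t, [/\ hvec (hd C b) (dg C b + s) t,
    forall c, bd t c = \sum_a df C b a * g a c & av f t = u * aug C b].
  by exists t; split; rewrite ?eqxx // => c; rewrite E.
case: (posnP (hd C b)) => [hb|hb].
  have Rb : R (aug C b).
    apply/(res_img Cr); exists (fun c => (c == b)%:R).
    rewrite /av (bigD1 b) //= eqxx rmorph1 mul1r big1 ?addr0 // => c cb.
    by rewrite (negPf cb) rmorph0 mul0r.
  have [t t1 t2] := img_hvec Cr' (uR _ Rb) (dhomogM uh (aug_homog Cr b)).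
  exists t; split; rewrite ?hb ?[(dg C b + s)%N]addnC // => c.
  rewrite big1 => [|a _].
    rewrite /bd big1 // => a _; have [->|/t1 [ha _ _]] := eqVneq (t a) 0.
      by rewrite mul0r.
    by have [->|/(df_hd Cr')] := eqVneq (df C' a c) 0; rewrite ?mulr0 // ha.
  by have [->|/(df_hd Cr)] := eqVneq (df C b a) 0; rewrite ?mul0r // hb.
pose v c := \sum_a df C b a * g a c.
have [|||t t1 t2] := @exact_hvec C' (hd C b).-1 (dg C b + s) v Cr'.
- apply: hvec_sum => a; apply: (@hvecZ _ _ _ (dg C a + s)) => d0.
    have [h1 h2] := df_homog Cr d0.
    by rewrite leq_add2r h1 subnDr.
  have ha := df_hd Cr d0; have [|h _ _] := gP a; first by rewrite ha.
  by rewrite ha.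
- move=> c; rewrite (@bd_linear C' v _ (index_enum _) g (df C b)) //.
  rewrite (eq_bigr (fun a => df C b a * \sum_a' df C a a' * g a' c)); last first.
    move=> a _; have [->|d0] := eqVneq (df C b a) 0; first by rewrite !mul0r.
    by case: (gP a) => [|_ -> //]; rewrite (df_hd Cr d0).
  have := @bd_linear C (fun a => bd (df C b) a) _ (index_enum _) (df C) (df C b).
  rewrite (eq_bigr (fun a => \sum_a' df C b a * df C a a' * g a' c)); last first.
    by move=> a _; rewrite mulr_sumr; apply: eq_bigr => a' _; rewrite mulrA.
  rewrite exchange_big /= big1 // => a' _; rewrite -mulr_suml.
  by have := df_df Cr b a'; rewrite /bd => ->; rewrite mul0r.
- rewrite (@av_linear C' v _ (index_enum _) g (df C b)) //.
  rewrite (eq_bigr (fun a => u * (f (df C b a) * aug C a))); last first.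
    move=> a _; have [->|d0] := eqVneq (df C b a) 0.
      by rewrite rmorph0 !mul0r mulr0.
    case: (gP a) => [|_ _ ->]; first by rewrite (df_hd Cr d0).
    by rewrite mulrCA.
  by rewrite -mulr_sumr; have := df_aug Cr b; rewrite /av => ->; rewrite mulr0.
exists t; rewrite prednK // in t1; split=> // [c|]; first by rewrite -t2.
have -> : aug C b = 0.
  by apply/eqP; apply: contraTT hb => /(aug_hd Cr) ->.
by rewrite mulr0; apply: (@av_hvec _ (hd C b).-1 (dg C b + s) _ Cr'); rewrite prednK.
Qed.

(** In every degree, 0 included, [p b] minus the homotopy applied to the boundary of [b] is a cycle
    killed by the augmentation, so exactness of the augmented complex supplies the next value of the
    homotopy. *)
Lemma null_homotopic (p : gen C -> gen C' -> S) :
    (forall b, hvec (hd C b) (dg C b) (p b)) ->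
    (forall b c, bd (p b) c = \sum_a df C b a * p a c) ->
    (forall b, av f (p b) = 0) ->
  exists2 h : gen C -> gen C' -> S, forall b, hvec (hd C b).+1 (dg C b) (h b) &
    forall b c, p b c = bd (h b) c + \sum_a df C b a * h a c.
Proof.
move=> ph pd pa; pose P (h : gen C -> gen C' -> S) b :=
  hvec (hd C b).+1 (dg C b) (h b) /\
  forall c, p b c = bd (h b) c + \sum_a df C b a * h a c.
suff [h hP] : exists h, forall b, P h b by exists h => b; case: (hP b).
apply: (@hd_recursion _ (hd C) _ (fun=> 0)) => [b g g' gb glt [P1 P2]|b g gP].
  split; rewrite -?gb // => c; rewrite P2; congr (_ + _); apply: eq_bigr => a _.
  by have [->|/(df_hd Cr) h] := eqVneq (df C b a) 0; rewrite ?mul0r // glt ?h.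
pose v c := p b c - \sum_a df C b a * g a c.
have [|||t t1 t2] := @exact_hvec C' (hd C b) (dg C b) v Cr'.
- apply: hvecD => //; apply: hvecN; apply: hvec_sum => a.
  apply: (@hvecZ _ _ _ (dg C a)) => d0; first exact: (df_homog Cr d0).
  by have [|h _] := gP a; rewrite (df_hd Cr d0).
- move=> c; rewrite bdD bdN pd (@bd_linear C' _ _ (index_enum _) g (df C b)) //.
  rewrite -sumrB (eq_bigr (fun a => df C b a * \sum_a' df C a a' * g a' c)); last first.
    move=> a _; have [->|d0] := eqVneq (df C b a) 0; first by rewrite !mul0r subr0.
    case: (gP a) => [|_ ->]; first by rewrite (df_hd Cr d0).
    by rewrite -mulrBr addrC addKr.
  rewrite (eq_bigr (fun a => \sum_a' df C b a * df C a a' * g a' c)); last first.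
    by move=> a _; rewrite mulr_sumr; apply: eq_bigr => a' _; rewrite mulrA.
  rewrite exchange_big /= big1 // => a' _; rewrite -mulr_suml.
  by have := df_df Cr b a'; rewrite /bd => ->; rewrite mul0r.
- rewrite avD avN pa sub0r (@av_linear C' _ _ (index_enum _) g (df C b)) //.
  rewrite big1 ?oppr0 // => a _; have [->|d0] := eqVneq (df C b a) 0.
    by rewrite rmorph0 mul0r.
  rewrite (av_hvec Cr' (i := hd C a) (j := dg C a)) ?mulr0 //.
  by case: (gP a); rewrite ?(df_hd Cr d0).
exists t; split; rewrite ?eqxx // => c; rewrite -t2 /v -addrA.
rewrite -[LHS]addr0; congr (_ + _); apply/esym/eqP; rewrite addrC subr_eq0.
apply/eqP; apply: eq_bigr => a _; case: eqP => // ->.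
have [->|/(df_hd Cr) /eqP] := eqVneq (df C b b) 0; first by rewrite !mul0r.
by rewrite eqn_leq ltnn andbF.
Qed.

End Compare.

(* The identity of [C] is homotopic to a map through [C'].  On [e] the homotopy
   has no constant coefficients, so the map does, and these preserve degrees. *)
Lemma res_gen_transfer C C' e : is_res f R C -> is_res f R C' ->
    (forall a, (df C e a)@_0%MM = 0 /\ (df C a e)@_0%MM = 0) ->
  exists e', hd C' e' = hd C e /\ dg C' e' = dg C e.
Proof.
move=> Cr Cr' emin.
have [|x|g [g1 g2 g3]] := @chain_lift C C' Cr Cr' 1 0; rewrite ?dhomog1 ?mul1r //.
have [|x|g' [g'1 g'2 g'3]] := @chain_lift C' C Cr' Cr 1 0; rewrite ?dhomog1 ?mul1r //.
pose q b c := \sum_x g b x * g' x c.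
have qh b : hvec (hd C b) (dg C b) (q b).
  apply: hvec_sum => x; apply: (@hvecZ _ _ _ (dg C' x)) => d0.
    by have [_] := g1 _ _ d0; rewrite addn0.
  by have [<- _ _] := g1 _ _ d0; have := g'1 x; rewrite addn0.
pose p b c := (b == c)%:R - q b c.
have [|b c|b|h h1 h2] := @null_homotopic C C Cr Cr p.
- move=> b; apply: hvecD; last exact: hvecN.
  move=> c /=; case: (b =P c) => [<- _|]; last by rewrite eqxx.
  by rewrite leqnn subnn dhomog1.
- have E : bd (q b) c = \sum_a df C b a * q a c.
    rewrite (@bd_linear C _ _ (index_enum _) g' (g b)) //.
    rewrite (eq_bigr (fun x => \sum_y g b x * df C' x y * g' y c)); last first.
      by move=> x _; rewrite g'2 mulr_sumr; apply: eq_bigr => y _; rewrite mulrA.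
    rewrite exchange_big /=.
    rewrite (eq_bigr (fun y => (\sum_a df C b a * g a y) * g' y c)); last first.
      by move=> y _; rewrite -mulr_suml -g2.
    rewrite /q (eq_bigr (fun y => \sum_a df C b a * (g a y * g' y c))); last first.
      by move=> y _; rewrite mulr_suml; apply: eq_bigr => a _; rewrite mulrA.
    by rewrite exchange_big; apply: eq_bigr => a _; rewrite mulr_sumr.
  rewrite bdD bdN E [RHS](eq_bigr (fun a => df C b a * (a == c)%:R - df C b a * q a c)).
    rewrite sumrB; congr (_ - _); rewrite /bd (bigD1 b) //= eqxx mul1r.
    rewrite [RHS](bigD1 c) //= eqxx mulr1 !big1 // => a ac.
      by rewrite (negPf ac) mulr0.
    by rewrite eq_sym (negPf ac) mul0r.
  by move=> a _; rewrite mulrBr.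
- rewrite avD avN (@av_linear C (q b) _ (index_enum _) g' (g b)) //.
  rewrite (eq_bigr (fun x => f (g b x) * aug C' x)); last first.
    by move=> x _; rewrite g'3 mul1r.
  have := g3 b; rewrite /av mul1r => ->; rewrite (bigD1 b) //= eqxx rmorph1 mul1r.
  by rewrite big1 ?addr0 ?subrr // => a ab; rewrite eq_sym (negPf ab) rmorph0 mul0r.
have : (p e e)@_0%MM = 0.
  rewrite h2 mcoeffD /bd !raddf_sum /= !big1 ?addr0 // => a _.
    by rewrite rmorphM /= (emin a).1 mul0r.
  by rewrite rmorphM /= (emin a).2 mulr0.
rewrite /p eqxx mcoeffB mcoeff1 eqxx /q raddf_sum /= => /eqP; rewrite subr_eq0.
(* The constant terms of the products [g e x * g' x e] add up to 1, so some entry [g e x] has a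
   nonzero constant term. Being homogeneous of degree [dg C e - dg C' x], it forces the two degrees
   to agree. *)
case: (pickP (fun x => (g e x)@_0%MM != 0)) => [x x0 _|x0]; last first.
  rewrite big1 ?oner_eq0 // => x _.
  by have /negbFE/eqP := x0 x; rewrite rmorphM /= => ->; rewrite mul0r.
have gx : g e x != 0 by apply: contraNneq x0 => ->; rewrite mcoeff0.
have [h3 h4 h5] := g1 e x gx; exists x; split=> //.
have /eqP := mcoeff0_homog h5 x0; rewrite subn_eq0 addn0 => h6.
by apply/eqP; rewrite eqn_leq h6 -[dg C e]addn0 h4.
Qed.

End Lift.
End BasedComplex.

Arguments hd {K n k} b _.
Arguments dg {K n k} b _.
Arguments df {K n k} b _ _.
Arguments aug {K n k} b _.

(** * Elimination of unit entries *)

Section Eliminate.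
Context (K : fieldType) (n k : nat) (mf : measure k).
Local Notation U := {mpoly K[k]}.
Local Notation S := {mpoly K[n]}.
Context (f : {rmorphism S -> U}) (R : U -> Prop).
Context (C : bcx K n k) (Cr : is_res mf f R C) (a b : gen C).
Hypothesis ab0 : (df C a b)@_0%MM != 0.

Let A : {pred gen C} := [pred x | (x != a) && (x != b)].
Let ci : S := ((df C a b)@_0%MM)^-1%:MP.
(** The Schur complement of the pivot at [(a, b)]. Its row [a] and column [b] vanish, so sums over
    the remaining generators can be taken over all of [gen C]. *)
Let D' x y := df C x y - df C x b * ci * df C a y.

Definition elim_gen : bcx K n k :=
  @Bcx K n k {x : gen C | x \in A} (fun x => hd C (val x)) (fun x => dg C (val x))
    (fun x y => D' (val x) (val y)) (fun x => aug C (val x)).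

Let dab0 : df C a b != 0.
Proof. by apply: contraNneq ab0 => ->; rewrite mcoeff0. Qed.

Let dgab : dg C a = dg C b.
Proof.
have [h1 h2] := df_homog Cr dab0; have /eqP := mcoeff0_homog h2 ab0.
by rewrite subn_eq0 => h3; apply/eqP; rewrite eqn_leq h1 h3.
Qed.

Let dabE : df C a b = ((df C a b)@_0%MM)%:MP.
Proof.
have [h1 h2] := df_homog Cr dab0.
by apply: dhomog0C; move: h2; rewrite dgab subnn.
Qed.

Let ciK : ci * df C a b = 1.
Proof. by rewrite {1}dabE /ci -mpolyCM mulVf ?mpolyC1. Qed.

Let hdab : hd C a = (hd C b).+1.
Proof. exact: (df_hd Cr dab0). Qed.

Let anb : a != b.
Proof. by apply/eqP => E; move/eqP: hdab; rewrite E eqn_leq ltnn andbF. Qed.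

Let auga : aug C a = 0.
Proof. by apply/eqP; apply/negPn/negP => /(aug_hd Cr); rewrite hdab. Qed.

Let D'a y : D' a y = 0.
Proof. by rewrite /D' [df C a b * _]mulrC ciK mul1r subrr. Qed.

Let D'b x : D' x b = 0.
Proof. by rewrite /D' -mulrA ciK mulr1 subrr. Qed.

Let sumA (V : nmodType) (F : gen C -> V) : F a = 0 -> F b = 0 ->
  \sum_(x : {x : gen C | x \in A}) F (val x) = \sum_x F x.
Proof.
move=> Fa Fb; rewrite -big_sub [RHS](bigD1 a) //= Fa add0r [RHS](bigD1 b) 1?eq_sym //= Fb add0r.
by apply: eq_bigl => x; rewrite inE andbC.
Qed.

Let bdD' (v : gen C -> S) y :
  \sum_x v x * D' x y = bd v y - bd v b * ci * df C a y.
Proof.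
rewrite /bd !mulr_suml -sumrB; apply: eq_bigr => x _.
by rewrite /D' mulrBr !mulrA.
Qed.

Lemma elim_gen_res : is_res mf f R elim_gen.
Proof.
split=> /=.
- move=> x y; rewrite /D'; have [->|d _] := eqVneq (df C (val x) (val y)) 0.
    rewrite sub0r oppr_eq0 !mulf_eq0 !negb_or => /andP [/andP [d1 _] d2].
    by rewrite (df_hd Cr d1) -hdab (df_hd Cr d2).
  exact: (df_hd Cr d).
- move=> x y d; have H : df C (val x) b * ci * df C a (val y) != 0 ->
      (dg C (val y) <= dg C (val x))%N /\ df C (val x) b * ci * df C a (val y)
        \is (dg C (val x) - dg C (val y)).-homog.
    rewrite !mulf_eq0 !negb_or => /andP [/andP [d1 _] d2].
    have [h1 h2] := df_homog Cr d1; have [h3 h4] := df_homog Cr d2.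
    rewrite -dgab in h1 h2; split; first exact: leq_trans h3 h1.
    have -> : (dg C (val x) - dg C (val y) =
      (dg C (val x) - dg C a) + 0 + (dg C a - dg C (val y)))%N.
      by rewrite addn0 addnBA // subnK.
    by apply: dhomogM => //; apply: dhomogM => //; rewrite dhomogE msuppC;
      case: ifP => //= _; rewrite mdeg0.
  move: d; rewrite /D'.
  have [->|d1] := eqVneq (df C (val x) b * ci * df C a (val y)) 0.
    by rewrite subr0; apply: (df_homog Cr).
  have [h1 h2] := H d1; have [->|/(df_homog Cr) [h3 h4] _] := eqVneq (df C (val x) (val y)) 0.
    by rewrite sub0r dhomogN.
  by split=> //; apply: dhomogD => //; rewrite dhomogN.
- by move=> x; apply: (aug_hd Cr).
- by move=> x; apply: (aug_homog Cr).
- move=> x z; rewrite /bd /= (sumA (F := fun y => D' (val x) y * D' y (val z))).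
  + rewrite bdD' /bd.
    have E c : \sum_y D' (val x) y * df C y c = 0.
      rewrite /D' (eq_bigr (fun y => df C (val x) y * df C y c -
          df C (val x) b * ci * (df C a y * df C y c))); last first.
        by move=> y _; rewrite mulrBl !mulrA.
      rewrite sumrB -mulr_sumr; have := df_df Cr (val x) c; rewrite /bd => ->.
      by have := df_df Cr a c; rewrite /bd => ->; rewrite mulr0 subr0.
    by rewrite !E !mul0r subr0.
  + by rewrite D'a mulr0.
  + by rewrite D'b mul0r.
- move=> x; rewrite /av /= (sumA (F := fun y => f (D' (val x) y) * aug C y)).
  + rewrite (eq_bigr (fun y => f (df C (val x) y) * aug C y -
        f (df C (val x) b * ci) * (f (df C a y) * aug C y))); last first.
      by move=> y _; rewrite /D' rmorphB [f (_ * _ * _)]rmorphM mulrBl !mulrA.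
    rewrite sumrB -mulr_sumr; have := df_aug Cr (val x); rewrite /av => ->.
    by have := df_aug Cr a; rewrite /av => ->; rewrite mulr0 subr0.
  + by rewrite auga mulr0.
  + by rewrite D'b rmorph0 mul0r.
- move=> v' vd va.
  pose u x := if insub x is Some x' then v' x' else 0.
  have uE x : u (val x) = v' x by rewrite /u valK.
  have u0 x : x \notin A -> u x = 0 by move=> h; rewrite /u insubN.
  have ua : u a = 0 by rewrite u0 // inE eqxx.
  have ub : u b = 0 by rewrite u0 // inE eqxx andbF.
  (* The coefficient at [a] is chosen so that the boundary in [C] vanishes at the deleted generator
     [b]. *)
  pose v x := u x + (if x == a then - (bd u b * ci) else 0).
  have vdE y : bd v y = \sum_x u x * D' x y.
    rewrite bdD' /v bdD; congr (_ + _); move: (bd u b) => t.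
    rewrite /bd (bigD1 a) //= eqxx big1 ?addr0 ?mulNr // => x xa.
    by rewrite (negPf xa) mul0r.
  have vd0 y : y != a -> bd v y = 0.
    move=> ya; rewrite vdE; have [->|yb] := eqVneq y b.
      by rewrite big1 // => x _; rewrite D'b mulr0.
    have yA : y \in A by rewrite inE ya yb.
    rewrite -[RHS](vd (Sub y yA)) -[LHS](sumA (F := fun x => u x * D' x y)).
    + by apply: eq_bigr => x _; rewrite uE.
    + by rewrite ua mul0r.
    + by rewrite ub mul0r.
  (* Only the coordinate at [a] is left in the boundary of [v]; applying the differential again and
     reading off at [b] multiplies it by the pivot, so it is zero. *)
  have vda : bd v a = 0.
    have := bd_bd v b (df_df Cr); rewrite {1}/bd (bigD1 a) //= big1 => [|x xa].
      by rewrite addr0 => /eqP; rewrite mulf_eq0 (negPf dab0) orbF => /eqP.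
    by rewrite vd0 ?mul0r.
  have [||w wE] := @res_exact _ _ _ _ _ _ _ Cr v.
  + by move=> y; have [->|] := eqVneq y a; [exact: vda | exact: vd0].
  + rewrite avD [X in _ + X]big1 ?addr0 => [|x _].
      rewrite -[RHS]va -[LHS](sumA (F := fun x => f (u x) * aug C x)).
      * by apply: eq_bigr => x _; rewrite uE.
      * by rewrite ua rmorph0 mul0r.
      * by rewrite ub rmorph0 mul0r.
    by case: eqP => [->|]; rewrite ?auga ?mulr0 // rmorph0 mul0r.
  (* A multiple of the boundary of [a] is subtracted: this clears the coordinate at [b] without
     changing the boundary. *)
  pose w' x := w x - w b * ci * df C a x.
  have w'b : w' b = 0 by rewrite /w' -mulrA ciK mulr1 subrr.
  have w'd y : bd w' y = v y.
    rewrite bdD bdN -wE -[RHS]subr0; congr (_ - _).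
    rewrite /bd (eq_bigr (fun x => w b * ci * (df C a x * df C x y))).
      by rewrite -mulr_sumr; have := df_df Cr a y; rewrite /bd => ->; rewrite mulr0.
    by move=> x _; rewrite mulrA.
  exists (fun x => w' (val x)) => y; rewrite /bd /=.
  rewrite (sumA (F := fun x => w' x * D' x (val y))).
  + rewrite bdD' !w'd /v ub add0r [b == a]eq_sym (negPf anb) !mul0r subr0 uE.
    by have := valP y; rewrite inE => /andP [/negPf -> _]; rewrite addr0.
  + by rewrite D'a mulr0.
  + by rewrite w'b mul0r.
- move=> u; split=> [/(res_img Cr) [v vE]|[v ->]]; last first.
    apply/(res_img Cr); exists (fun x => if insub x is Some x' then v x' else 0).
    rewrite -[RHS](sumA (F := fun x =>
       f (if insub x is Some x' then v x' else 0) * aug C x)).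
    + by apply: eq_bigr => x _; rewrite valK.
    + by rewrite auga mulr0.
    + by rewrite insubN ?rmorph0 ?mul0r // inE eqxx andbF.
  pose v' x := v x - v b * ci * df C a x.
  exists (fun x => v' (val x)); rewrite /av /= (sumA (F := fun x => f (v' x) * aug C x)).
  + rewrite vE [LHS]/av.
    rewrite [RHS](eq_bigr (fun x => f (v x) * aug C x - f (v b * ci) * (f (df C a x) * aug C x))).
      rewrite sumrB -mulr_sumr; have := df_aug Cr a; rewrite /av => ->.
      by rewrite mulr0 subr0.
    by move=> x _; rewrite /v' rmorphB [f (_ * _ * _)]rmorphM mulrBl mulrA.
  + by rewrite auga mulr0.
  + by rewrite /v' -mulrA ciK mulr1 subrr rmorph0 mul0r.
Qed.

Lemma elim_gen_card : (#|gen elim_gen| < #|gen C|)%N.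
Proof.
rewrite /= card_sig -[X in (_ < X)%N](cardC A) -[X in (X < _)%N]addn0 ltn_add2l.
by apply/card_gt0P; exists a; rewrite !inE eqxx.
Qed.

End Eliminate.

Section Minimal.
Context (K : fieldType) (n k : nat) (mf : measure k).
Local Notation U := {mpoly K[k]}.
Local Notation S := {mpoly K[n]}.
Context (f : {rmorphism S -> U}) (R : U -> Prop).

Lemma min_res_exists (C : bcx K n k) : is_res mf f R C ->
  exists2 C' : bcx K n k, is_res mf f R C' & forall a b, (df C' a b)@_0%MM = 0.
Proof.
have [m] := ubnP #|gen C|; elim: m C => // m IH C; rewrite ltnS => cC Cr.
have [/existsP [a /existsP [b ab0]]|min] :=
    boolP [exists a, exists b, (df C a b)@_0%MM != 0].
  apply: (IH (elim_gen a b)); last exact: elim_gen_res ab0.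
  exact: leq_trans (elim_gen_card a b) cC.
exists C => // a b; apply/eqP; apply: contraNT min => ab0.
by apply/existsP; exists a; apply/existsP; exists b.
Qed.

End Minimal.

(** * Resolutions as based complexes *)

Section Conversion.
Context (K : fieldType) (disp : Order.disp_t) (T : finPOrderType disp).
Local Notation n := #|{: ideal T}|.
Local Notation S := {mpoly K[n]}.
Context (k : nat) (mf : measure k).
Local Notation U := {mpoly K[k]}.
Context (f : {rmorphism S -> U}) (R : U -> Prop).
Hypothesis fh : forall d p, p \is d.-homog -> f p \is d.-homog for mf.
Hypothesis kerf : forall q, in_hibi_ideal q <-> f q = 0.
Hypothesis imf : forall u, R u <-> exists s, u = f s.

(** * From a minimal resolution to a based complex *)

Section OfResolution.
Context (F : resolution T K) (Fr : is_min_graded_free_resolution F).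
Local Notation p := (res_len F).
Local Notation b := (res_rank F).
Local Notation d := (@res_deg _ _ _ F).
Local Notation M := (res_map F).

(** Indices are plain numbers, so ordinals over equal but not convertible ranks need no casts.
    Entries from index [p] on are set to 0, since [res_map] is arbitrary there. *)
Let E j (x y : nat) : S :=
  if (j < p)%N then
    if insub x is Some x' then if insub y is Some y' then M j x' y' else 0 else 0
  else 0.

Let E_ord j (x : 'I_(b j.+1)) (y : 'I_(b j)) : (j < p)%N -> E j x y = M j x y.
Proof. by move=> jp; rewrite /E jp !valK. Qed.

Definition bcx_of_res : bcx K n k :=
  @Bcx K n k {i : 'I_p.+1 & 'I_(b i)} (fun x => tag x) (fun x => d (tagged x))
    (fun x y => if tag x == (tag y).+1 :> nat then E (tag y) (tagged x) (tagged y) else 0)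
    (fun x => if tag x == 0%N :> nat then 1 else 0).
Local Notation C := bcx_of_res.

Let Gen i (ip : (i < p.+1)%N) (x : 'I_(b i)) : gen C :=
  @Tagged _ (Ordinal ip) (fun j : 'I_p.+1 => 'I_(b j)) x.

Let sum_gen (V : nmodType) (G : gen C -> V) :
  \sum_x G x = \sum_(i < p.+1) \sum_(x < b i) G (@Tagged _ i (fun j : 'I_p.+1 => 'I_(b j)) x).
Proof.
rewrite (sig_big_dep xpredT (fun _ _ => true)
  (fun i x => G (@Tagged _ i (fun j : 'I_p.+1 => 'I_(b j)) x))) /=.
by apply: eq_big => // -[i x].
Qed.

Let sum_gen_at (V : nmodType) (G : gen C -> V) i (ip : (i < p.+1)%N) :
  (forall x, hd C x != i -> G x = 0) -> \sum_x G x = \sum_(x < b i) G (Gen ip x).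
Proof.
move=> G0; rewrite sum_gen (bigD1 (Ordinal ip)) //= [X in _ + X]big1 ?addr0 // => j ji.
by apply: big1 => x _; apply: G0.
Qed.

Let bd_gen (v : gen C -> S) i (ip : (i < p.+1)%N) (ip1 : (i.+1 < p.+1)%N) y :
  bd v (Gen ip y) = ((\row_x v (Gen ip1 x)) *m M i) ord0 y.
Proof.
rewrite /bd (@sum_gen_at _ _ i.+1 ip1) /= => [|x].
  by rewrite mxE; apply: eq_bigr => x _; rewrite eqxx E_ord // mxE.
by case: eqP => //; rewrite mulr0.
Qed.

Let bd_top (v : gen C -> S) (ip : (p < p.+1)%N) y : bd v (Gen ip y) = 0.
Proof.
rewrite /bd big1 // => x _ /=; case: eqP => h; rewrite ?mulr0 //.
by have := ltn_ord (tag x); rewrite [X in (X < _)%N]h ltnn.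
Qed.

Lemma bcx_of_res_min x y : (df C x y)@_0%MM = 0.
Proof.
have [_ Mh _ _ _] := Fr; rewrite /= /E; case: eqP => _; rewrite ?mcoeff0 //.
case: ifP => [jp|_]; rewrite ?mcoeff0 //.
case: insubP => [x' _ _|_]; rewrite ?mcoeff0 //.
case: insubP => [y' _ _|_]; rewrite ?mcoeff0 //.
apply/eqP; apply/negPn/negP => m0.
have [|h1 h2] := Mh _ jp x' y'; first by apply: contraNneq m0 => ->; rewrite mcoeff0.
have /eqP := mcoeff0_homog h2 m0.
by rewrite subn_eq0 leqNgt h1.
Qed.

Let b0 : b 0%N = 1%N. Proof. by case: Fr => -[]. Qed.

Let sum_b0 (G : 'I_(b 0%N) -> S) y : \sum_(x < b 0%N) G x = G y.
Proof.
rewrite (bigD1 y) //= big1 ?addr0 // => x; rewrite -val_eqE /=.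
have := ltn_ord x; have := ltn_ord y; move: (val x) (val y) => x' y'.
by rewrite b0 !ltnS !leqn0 => /eqP -> /eqP ->; rewrite eqxx.
Qed.

Let av_gen (v : gen C -> S) : av f v = f (\sum_(x < b 0%N) v (Gen (ltn0Sn p) x)).
Proof.
rewrite /av (@sum_gen_at _ _ 0%N (ltn0Sn p)) /= => [|x].
  by rewrite rmorph_sum; apply: eq_bigr => x _; rewrite mulr1.
by case: eqP => //; rewrite mulr0.
Qed.

Lemma bcx_of_res_is_res : is_res mf f R C.
Proof.
have [[_ d0] Mh [Mp0 Mp] Mex Mtop] := Fr.
split=> /=.
- by move=> x y; case: ifP => [/eqP //|_]; rewrite eqxx.
- move=> [i x] [j y] /=; case: ifP => [/eqP ij|_]; rewrite ?eqxx // /E.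
  case: ifP => [jp|]; rewrite ?eqxx //; case: insubP => [x' _ xx'|]; rewrite ?eqxx //.
  case: insubP => [y' _ yy'|]; rewrite ?eqxx // => m0; have [h1 h2] := Mh _ jp _ _ m0.
  have ey : y' = y by apply: val_inj.
  have ex : d x = d x'.
    move: x' xx' {m0 h1 h2}; rewrite -ij => x' xx'; congr res_deg.
    by apply: val_inj; rewrite xx'.
  by rewrite ex -ey ltnW.
- by move=> [i x] /=; case: ifP => [/eqP //|_]; rewrite eqxx.
- move=> [i x] /=; case: ifP => [/eqP i0|_]; last exact: dhomog0.
  suff -> : d x = 0%N by apply: dhomog1.
  by move: x; rewrite i0 => x; apply: d0.
- move=> x [[i ip] y]; case: (ltnP i p) => ltip; last first.
    have ei : i = p by apply/eqP; rewrite eqn_leq ltip -ltnS ip.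
    by subst i; apply: bd_top.
  rewrite (@bd_gen _ i ip ltip).
  case: (nat_of_ord (tag x) =P i.+2) => hx; last first.
    by rewrite mxE big1 // => z _; rewrite mxE /= mul0r.
  have lt2 : (i.+1 < p)%N by rewrite -ltnS -hx ltn_ord.
  have xb : (tagged x < b i.+2)%N by move: (tagged x); rewrite hx => x'.
  suff -> : \row_z E i.+1 (tagged x) z = delta_mx ord0 (Ordinal xb) *m M i.+1.
    have [_ H] := Mex i lt2 (delta_mx ord0 (Ordinal xb) *m M i.+1).
    by rewrite H ?mxE //; exists (delta_mx ord0 (Ordinal xb)).
  apply/rowP => z; rewrite -rowE !mxE.
  by rewrite -(@E_ord i.+1 (Ordinal xb)).
- move=> x; rewrite av_gen.
  case: (nat_of_ord (tag x) =P 1%N) => hx; last first.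
    by rewrite big1 ?rmorph0.
  have p0 : (0 < p)%N by rewrite -ltnS -hx ltn_ord.
  have xb : (tagged x < b 1%N)%N by move: (tagged x); rewrite hx => x'.
  apply/kerf/(Mp p0); exists (delta_mx ord0 (Ordinal xb)).
  apply: eq_bigr => z _; rewrite -rowE !mxE /=.
  by rewrite -(@E_ord 0%N (Ordinal xb)).
- move=> v vd va.
  (* Exactness is used one homological degree at a time: the description of the Hibi ideal in degree
     0, exactness in the middle, injectivity of the last map in degree [p]. The rows are functions
     on [nat] so that their type does not depend on [i]. *)
  have /fin_all_exists [W WP] (i : 'I_p.+1) : exists w : nat -> S, forall y : 'I_(b i),
      v (@Tagged _ i (fun j : 'I_p.+1 => 'I_(b j)) y) =
      if (i < p)%N then \sum_(x < b i.+1) w x * M i x y else 0.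
    case: i => i ip /=.
    suff [w wE] : exists w : 'rV[S]_(b i.+1), forall y : 'I_(b i), v (Gen ip y) =
        if (i < p)%N then (w *m M i) ord0 y else 0.
      exists (fun x => if insub x is Some x' then w ord0 x' else 0) => y.
      rewrite wE; case: ifP => // _; rewrite mxE; apply: eq_bigr => x _.
      by rewrite valK.
    case: i ip => [|i] ip.
      have v0 y : v (Gen ip y) = \sum_(x < b 0%N) v (Gen (ltn0Sn p) x).
        by rewrite (sum_b0 _ y) (bool_irrelevance ip (ltn0Sn p)).
      case: (posnP p) => p0.
        exists 0 => y; rewrite v0; apply/(Mp0 p0)/kerf.
        by rewrite -av_gen.
      have [w wE] : exists w : 'rV[S]_(b 1%N),
          \sum_(x < b 0%N) v (Gen (ltn0Sn p) x) = \sum_x (w *m M 0%N) ord0 x.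
        by apply/(Mp p0)/kerf; rewrite -av_gen.
      by exists w => y; rewrite v0 wE (sum_b0 _ y).
    have vk : (\row_x v (Gen ip x)) *m M i = 0.
      apply/rowP => y; rewrite -(@bd_gen v i (ltnW ip) ip) mxE; exact: vd.
    have : (i.+1 == p) || (i.+1 < p)%N by rewrite -leq_eqVlt -ltnS ip.
    case/orP => [/eqP ei|lti].
      exists 0 => y; rewrite ltnNge -ei leqnn /=.
      by have /rowP/(_ y) := Mtop i (esym ei) _ vk; rewrite !mxE.
    have [w wE] := (Mex i lti _).1 vk.
    exists w => y; rewrite lti -wE mxE //.
  exists (fun x : gen C => if (tag x : nat) is i.+1 then W (inord i) (tagged x) else 0).
  move=> [[i ip] y]; rewrite (WP (Ordinal ip)) /=; case: ltnP => ltip; last first.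
    have ei : i = p by apply/eqP; rewrite eqn_leq ltip -ltnS ip.
    by subst i; rewrite bd_top.
  rewrite (@bd_gen _ i ip ltip) mxE; apply: eq_bigr => x _; rewrite mxE /=.
  by congr (W _ _ * _); apply: val_inj; rewrite /= inordK.
- move=> u; split=> [/imf [s ->]|[v ->]]; last by apply/imf; rewrite av_gen; eexists.
  have y : 'I_(b 0%N) by rewrite b0; apply: ord0.
  by exists (fun=> s); rewrite av_gen (sum_b0 _ y).
Qed.

Lemma bcx_of_res_gen i (x : 'I_(b i)) : (i <= p)%N ->
  exists e : gen C, hd C e = i /\ dg C e = d x.
Proof. by move=> ip; exists (Gen (ip : i < p.+1)%N x). Qed.

Lemma bcx_of_res_reg (e : gen C) : (dg C e - hd C e <= res_reg F)%N.
Proof.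
case: e => i x /=; apply: leq_trans (leq_bigmax i).
exact: (leq_bigmax (F := fun x : 'I_(b i) => (d x - i)%N)).
Qed.

End OfResolution.

(** * From a based complex without unit entries to a minimal resolution *)

Section ToResolution.
Context (C : bcx K n k) (Cr : is_res mf f R C).
Hypothesis Cmin : forall a b, (df C a b)@_0%MM = 0.

(** As 1 lies in the image of the augmentation, some generator of bidegree 0 is sent to a nonzero
    constant. A second generator [b] in homological degree 0 would be a combination of it modulo the
    kernel, giving a cycle with coefficient 1 at [b]; that cycle is a boundary, whose coefficients
    have no constant term. *)
Lemma min_res_gen0 : exists b0 : gen C, exists2 c : S, f c * aug C b0 = 1 &
  [/\ hd C b0 = 0%N, dg C b0 = 0%N & forall b, hd C b = 0%N -> b = b0].
Proof.
have R1 : R 1 by apply/imf; exists 1; rewrite rmorph1.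
have [w wh w1] := img_hvec fh Cr R1 (dhomog1 _ _).
have [b0 wb0] : exists b0, f (w b0) * aug C b0 != 0.
  apply/existsP; apply: contraT; rewrite negb_exists => /forallP w0.
  have /eqP := w1; rewrite /av big1 ?oner_eq0 // => b _.
  exact/eqP/negbNE/w0.
have w0 : w b0 != 0 by apply: contraNneq wb0 => ->; rewrite rmorph0 mul0r.
have [hb0 db0 _] := wh _ w0; move: db0; rewrite leqn0 => /eqP db0.
have lin (b : gen C) : exists s, aug C b = f s.
  apply/imf/(res_img Cr); exists (fun c => (c == b)%:R).
  rewrite /av (bigD1 b) //= eqxx rmorph1 mul1r big1 ?addr0 // => c cb.
  by rewrite (negPf cb) rmorph0 mul0r.
have [c cE] : exists c : K, aug C b0 = f c%:MP.
  have [s sE] := lin b0; exists (part 0 0 s)@_0%MM.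
  rewrite -dhomog0C; last exact: (part_homog 0 0 s).
  rewrite -[RHS]mulr1 -(pihomog_morph _ _ fh (dhomog1 _ _)) mulr1 -sE.
  by rewrite pihomog_dE //; have := aug_homog Cr b0; rewrite db0.
have c0 : c != 0.
  by apply: contraNneq wb0 => c0; rewrite cE c0 mpolyC0 rmorph0 mulr0.
have fc : f (c^-1)%:MP * aug C b0 = 1.
  by rewrite cE -rmorphM -mpolyCM mulVf // mpolyC1 rmorph1.
exists b0; exists (c^-1)%:MP => //; split=> // b hb; apply/eqP.
apply: contraT => bb0; have [s sE] := lin b.
pose v x : S := if x == b then 1 else if x == b0 then - (s * (c^-1)%:MP) else 0.
have vhd x : v x != 0 -> hd C x = 0%N.
  by rewrite /v; case: ifP => [/eqP -> //|_]; case: ifP => [/eqP -> //|_]; rewrite eqxx.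
have [||u uE] := @res_exact _ _ _ _ _ _ _ Cr v.
- move=> y; rewrite /bd big1 // => x _.
  have [->|/vhd hx] := eqVneq (v x) 0; first by rewrite mul0r.
  by have [->|/(df_hd Cr)] := eqVneq (df C x y) 0; rewrite ?mulr0 // hx.
- rewrite /av (bigD1 b) //= (bigD1 b0) 1?eq_sym //= big1 => [|x /andP [xb xb0]].
    rewrite /v !eqxx eq_sym (negPf bb0) rmorph1 mul1r addr0 rmorphN rmorphM.
    by rewrite mulNr -mulrA fc mulr1 sE subrr.
  by rewrite /v (negPf xb) (negPf xb0) rmorph0 mul0r.
have /eqP := congr1 (fun q => q@_0%MM) (uE b).
rewrite /v eqxx mcoeff1 eqxx /bd raddf_sum /= big1 ?oner_eq0 // => x _.
by rewrite rmorphM /= Cmin mulr0.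
Qed.

Definition res_of_bcx : resolution T K :=
  @Resolution disp T K (\max_(x : gen C) hd C x) (fun i => #|[pred x | hd C x == i]|)
    (fun i x => dg C (enum_val x))
    (fun i => \matrix_(x, y) df C (enum_val x) (enum_val y)).
Local Notation b := (res_rank res_of_bcx).
Local Notation p := (res_len res_of_bcx).

Let hd_enum i (x : 'I_(b i)) : hd C (enum_val x) = i.
Proof. by have := enum_valP x; rewrite inE => /eqP. Qed.

Let ext i (v : 'rV[S]_(b i)) (x : gen C) : S :=
  \sum_y (enum_val y == x)%:R * v ord0 y.

Let ext_val i (v : 'rV[S]_(b i)) y : ext v (enum_val y) = v ord0 y.
Proof.
rewrite /ext (bigD1 y) //= eqxx mul1r big1 ?addr0 // => z zy.
by rewrite (inj_eq enum_val_inj) (negPf zy) mul0r.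
Qed.

Let ext0 i (v : 'rV[S]_(b i)) x : hd C x != i -> ext v x = 0.
Proof.
move=> hx; rewrite /ext big1 // => y _; case: eqP => [E|_]; rewrite ?mul0r //.
by move: hx; rewrite -E hd_enum eqxx.
Qed.

Let sum_hd (V : nmodType) (G : gen C -> V) i : (forall x, hd C x != i -> G x = 0) ->
  \sum_x G x = \sum_(x < b i) G (enum_val x).
Proof.
move=> G0; rewrite -(big_enum_val (A := [pred x | hd C x == i]) G) /=.
rewrite [RHS]big_mkcond; apply: eq_bigr => x _.
by rewrite inE; case: eqP => // /eqP /G0.
Qed.

Let bd_row (w : gen C -> S) i (y : 'I_(b i)) :
  bd w (enum_val y) = ((\row_x w (enum_val x)) *m res_map res_of_bcx i) ord0 y.
Proof.
rewrite /bd (@sum_hd _ _ i.+1) => [|x hx].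
  by rewrite mxE; apply: eq_bigr => x _; rewrite !mxE.
have [->|/(df_hd Cr)] := eqVneq (df C x (enum_val y)) 0; first by rewrite mulr0.
by rewrite hd_enum => E; rewrite E eqxx in hx.
Qed.

Let row_ext i (v : 'rV[S]_(b i)) : \row_x ext v (enum_val x) = v.
Proof. by apply/rowP => y; rewrite mxE ext_val. Qed.

Let bd_ext0 i (v : 'rV[S]_(b i.+1)) x : hd C x != i -> bd (ext v) x = 0.
Proof.
move=> hx; rewrite /bd big1 // => y _.
have [hy|/ext0 ->] := eqVneq (hd C y) i.+1; last by rewrite mul0r.
have [->|/(df_hd Cr)] := eqVneq (df C y x) 0; first by rewrite mulr0.
by rewrite hy => -[E]; rewrite E eqxx in hx.
Qed.

Let exact_row i (v : 'rV[S]_(b i.+1)) : v *m res_map res_of_bcx i = 0 ->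
  exists w : 'rV[S]_(b i.+2), v = w *m res_map res_of_bcx i.+1.
Proof.
move=> v0; have [||w wE] := @res_exact _ _ _ _ _ _ _ Cr (ext v).
- move=> x; have [hx|/bd_ext0 -> //] := eqVneq (hd C x) i.
  have xA : x \in [pred x | hd C x == i] by rewrite inE hx.
  by rewrite -(enum_rankK_in xA xA) bd_row row_ext v0 mxE.
- rewrite /av big1 // => x _.
  have [->|/(aug_hd Cr) hx] := eqVneq (aug C x) 0; first by rewrite mulr0.
  by rewrite ext0 ?hx // rmorph0 mul0r.
exists (\row_x w (enum_val x)); apply/rowP => y.
by rewrite -ext_val wE bd_row.
Qed.

Let rank_gt i : (p < i)%N -> b i = 0%N.
Proof.
move=> pi; apply: eq_card0 => x; rewrite inE; apply: ltn_eqF.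
by apply: leq_ltn_trans pi; apply: (leq_bigmax (F := fun x => hd C x)).
Qed.

Lemma res_of_bcx_min : is_min_graded_free_resolution res_of_bcx.
Proof.
have [b0 [c cb0 [hb0 db0 b0u]]] := min_res_gen0.
have card0 : b 0%N = 1%N.
  rewrite /= (@eq_card1 _ b0) // => x; rewrite !inE.
  by apply/eqP/eqP => [/b0u|->].
have e0 (x : 'I_(b 0%N)) : enum_val x = b0 by apply: b0u; apply: hd_enum.
have sum0 (G : 'I_(b 0%N) -> S) y : \sum_(x < b 0%N) G x = G y.
  rewrite (bigD1 y) //= big1 ?addr0 // => x; rewrite -(inj_eq enum_val_inj).
  by rewrite !e0 eqxx.
have y0 : 'I_(b 0%N) by rewrite card0; apply: ord0.
(* Since [b0] spans degree 0 and its augmentation is invertible, the kernel of the augmentation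
   there is the kernel of [f], which is the Hibi ideal. *)
have ker q : f q = 0 <-> exists w : gen C -> S, q = bd w b0.
  split=> [fq|[w ->]].
    have [||w wE] := @res_exact _ _ _ _ _ _ _ Cr (fun x => if x == b0 then q else 0).
    - move=> y; rewrite /bd big1 // => x _; case: eqP => [->|_]; last by rewrite mul0r.
      by have [->|/(df_hd Cr)] := eqVneq (df C b0 y) 0; rewrite ?mulr0 // hb0.
    - rewrite /av big1 // => x _; case: eqP => _; first by rewrite fq mul0r.
      by rewrite rmorph0 mul0r.
    by exists w; rewrite -wE eqxx.
  rewrite -[LHS]mulr1 -cb0 mulrCA; apply/eqP; rewrite mulf_eq0; apply/orP; right.
  apply/eqP; rewrite -(av_bd w (df_aug Cr)) /av (bigD1 b0) //= big1 ?addr0 // => x xb0.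
  have [->|/(aug_hd Cr) /b0u E] := eqVneq (aug C x) 0; first by rewrite mulr0.
  by rewrite E eqxx in xb0.
split.
- by split=> // x; rewrite /= e0.
- move=> i _ x y; rewrite mxE => d0; have [h1 h2] := df_homog Cr d0.
  split=> //; rewrite ltn_neqAle h1 andbT; apply: contraNneq d0 => /= E.
  by rewrite (dhomog0C (s := df C _ _)) ?Cmin ?mpolyC0 //; move: h2; rewrite /= E subnn.
- split=> [p0|p0] q; rewrite kerf ker; split.
  + move=> [w ->]; rewrite /bd big1 // => x _.
    have [->|/(df_hd Cr)] := eqVneq (df C x b0) 0; first by rewrite mulr0.
    have : (hd C x <= p)%N by apply: (leq_bigmax (F := fun x => hd C x)).
    by rewrite p0 leqn0 => /eqP ->.
  + by move=> ->; exists (fun=> 0); rewrite /bd big1 // => x _; rewrite mul0r.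
  + move=> [w ->]; exists (\row_x w (enum_val x)).
    by rewrite (sum0 _ y0) -bd_row e0.
  + move=> [w ->]; exists (ext w).
    by rewrite (sum0 _ y0) -(e0 y0) bd_row row_ext.
- move=> i _ v; split=> [|[w ->]]; first exact: exact_row.
  have -> : w *m res_map res_of_bcx i.+1 = \row_x bd (ext w) (enum_val x).
    by apply/rowP => x; rewrite [RHS]mxE bd_row row_ext.
  by apply/rowP => y; rewrite -bd_row (bd_bd _ _ (df_df Cr)) mxE.
- move=> j pj v /exact_row [w ->].
  have b2 : b j.+2 = 0%N by apply: rank_gt; rewrite pj.
  by apply/rowP => y; rewrite !mxE big1 // => -[x xb]; exfalso; move: xb; rewrite b2.
Qed.

End ToResolution.
End Conversion.

(** * Adjoining a variable *)

Section LastVariable.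
Context (K : fieldType) (n : nat).
Local Notation S := {mpoly K[n]}.
Local Notation S1 := {mpoly K[n.+1]}.
Local Notation Z := ('X_ord_max : S1).

Lemma muniX m : muni ('X_[m] : S1) =
  ('X_[[multinom m (widen_ord (leqnSn n) i) | i < n]])%:P * 'X^(m ord_max).
Proof. by rewrite muniE msuppX big_seq1 mcoeffX eqxx scale1r mul_polyC. Qed.

Lemma muni_mwiden (s : S) : muni (mwiden s) = s%:P.
Proof.
rewrite [in LHS](mpolyE s) [in RHS](mpolyE s) (big_morph _ (@mwidenD n K) (@mwiden0 n K)).
rewrite (big_morph _ (@muniD n K) (@muni0 n K)) (big_morph _ (@polyCD S) (polyC0 S)).
apply: eq_bigr => m _; rewrite mwidenZ mwidenX muniZ muniX mnmwiden_ordmax expr0 mulr1.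
have -> : [multinom (mnmwiden m) (widen_ord (leqnSn n) i) | i < n] = m.
  by apply/mnmP => i; rewrite mnmE mnmwiden_widen.
by rewrite -mul_mpolyC polyCM -mul_polyC.
Qed.

Lemma muni_last : muni Z = 'X.
Proof.
rewrite muniX mnm1E eqxx expr1.
have -> : [multinom U_(ord_max)%MM (widen_ord (leqnSn n) i) | i < n] = 0%MM.
  apply/mnmP => i; rewrite mnmE mnm0E mnm1E; case: eqP => // /(congr1 val) /= E.
  by have := ltn_ord i; rewrite -E ltnn.
by rewrite mpolyX0 mul1r.
Qed.

Definition zcoef t (s : S1) : S := (muni s)`_t.

Lemma zcoef_is_additive t : additive (zcoef t).
Proof. by move=> p q; rewrite /zcoef raddfB coefB. Qed.

HB.instance Definition _ t := GRing.isAdditive.Build S1 S (zcoef t) (zcoef_is_additive t).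

Lemma zcoefMw t (p : S1) (s : S) : zcoef t (p * mwiden s) = zcoef t p * s.
Proof. by rewrite /zcoef rmorphM /= muni_mwiden coefMC. Qed.

Lemma zcoefMZ t (p : S1) : zcoef t (p * Z) = if t is t'.+1 then zcoef t' p else 0.
Proof. by rewrite /zcoef rmorphM /= muni_last coefMX; case: t. Qed.

Lemma zcoef_wZ t (s : S) i : zcoef t (mwiden s * Z ^+ i) = if t == i then s else 0.
Proof.
rewrite /zcoef rmorphM rmorphXn /= muni_mwiden muni_last coefCM coefXn.
by case: eqP => _; rewrite ?mulr1 ?mulr0.
Qed.

Lemma zcoefK (p : S1) : p = \sum_(t < size (muni p)) mwiden (zcoef t p) * Z ^+ t.
Proof.
pose m (q : {poly S}) := (map_poly (@mwiden n K) q).[Z].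
have mE q : m q = \sum_(t < size q) mwiden q`_t * Z ^+ t.
  rewrite /m (@horner_coef_wide _ (size q)) ?size_poly //.
  by apply: eq_bigr => t _; rewrite coef_map.
rewrite -(mE (muni p)) [in LHS](mpolyE p) [in RHS](mpolyE p).
rewrite /m (big_morph _ (@muniD n K) (@muni0 n K)).
rewrite (big_morph (map_poly (@mwiden n K)) (raddfD _) (raddf0 _)) horner_sum; apply: eq_bigr => a _.
rewrite muniZ map_polyZ hornerZ.
transitivity ((p@_a)%:MP * (map_poly (@mwiden n K) (muni 'X_[a])).[Z]); last first.
  by congr (_ * _); exact/esym/mwidenC.
rewrite mul_mpolyC; congr (_ *: _).
have fCX (A B : nzRingType) (g : {rmorphism A -> B}) c i :
    map_poly g (c%:P * 'X^i) = (g c)%:P * 'X^i.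
  by rewrite rmorphM /= map_polyC map_polyXn.
rewrite muniX (fCX _ _ (@mwiden n K)) hornerCM hornerXn.
rewrite [X in _ = X * _]mwidenX.
rewrite mpolyXn -mpolyXD; congr 'X_[_]; apply/mnmP => i; rewrite mnmDE mulmnE mnm1E.
have [->|im] := eqVneq i ord_max; first by rewrite mnmwiden_ordmax mul1n.
have ilt : (i < n)%N.
  have := ltn_ord i; rewrite ltnS leq_eqVlt => /orP [/eqP E|//].
  by case/eqP: im; apply: val_inj.
have -> : i = widen_ord (leqnSn n) (Ordinal ilt) by apply: val_inj.
by rewrite mnmwiden_widen mnmE mul0n addn0.
Qed.

Lemma zcoef_eq0 (p : S1) : (forall t, zcoef t p = 0) -> p = 0.
Proof. by move=> p0; rewrite [p]zcoefK big1 // => t _; rewrite p0 raddf0 mul0r. Qed.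

Lemma mwiden_homog d (s : S) : s \is d.-homog -> mwiden s \is d.-homog.
Proof.
apply: (@rmorph_homog _ _ _ mdeg (@mwiden n K)) => [c|i] /=.
  by rewrite mwidenC dhomogE msuppC; case: ifP => //= _; rewrite mdeg0.
by rewrite mwidenX mnmwiden1 dhomogX /= mdeg1.
Qed.

End LastVariable.

(** * The mapping cone for one more variable *)

Section Cone.
Context (K : fieldType) (n k : nat) (mf : measure k).
Local Notation U := {mpoly K[k]}.
Local Notation S := {mpoly K[n]}.
Local Notation S1 := {mpoly K[n.+1]}.
Local Notation Z := ('X_ord_max : S1).
Context (f : {rmorphism S -> U}) (f1 : {rmorphism S1 -> U}) (R : U -> Prop).
Hypothesis f1f : forall s, f1 (mwiden s) = f s.
Context (C : bcx K n k) (Cr : is_res mf f R C) (N : gen C -> gen C -> S).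
Hypothesis Nh : forall b, hvec (hd C b) (dg C b + 1) (N b).
Hypothesis Nd : forall b c, bd (N b) c = \sum_a df C b a * N a c.
Hypothesis Na : forall b, av f (N b) = f1 Z * aug C b.
Hypothesis RD : forall x y, R x -> R y -> R (x + y).
Hypothesis RM : forall s x, R x -> R (f1 s * x).

(* The mapping cone of [Z - N], where the chain map [N] lifts multiplication by
   the image of the new variable [Z]. *)
Definition cone : bcx K n.+1 k :=
  @Bcx K n.+1 k (gen C * bool)%type
    (fun x => hd C x.1 + x.2)%N (fun x => dg C x.1 + x.2)%N
    (fun x y => match x.2, y.2 with
      | false, false => mwiden (df C x.1 y.1)
      | true, false => (if x.1 == y.1 then Z else 0) - mwiden (N x.1 y.1)
      | true, true => - mwiden (df C x.1 y.1)
      | false, true => 0 end)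
    (fun x => if x.2 then 0 else aug C x.1).

Let sum_cone (V : nmodType) (G : gen cone -> V) :
  \sum_x G x = \sum_(x : gen C) G (x, false) + \sum_(x : gen C) G (x, true).
Proof.
rewrite (eq_bigr (fun x => G (x.1, x.2))) => [|[]//].
rewrite -(pair_bigA _ (fun x y => G (x, y))) exchange_big /= big_bool /= addrC.
by [].
Qed.

Let wbd (v : gen C -> S1) y := \sum_x v x * mwiden (df C x y).

Let bd_true (v : gen cone -> S1) y : bd v (y, true) = - wbd (fun x => v (x, true)) y.
Proof.
rewrite /bd sum_cone /= big1 ?add0r => [|x _]; last by rewrite mulr0.
by rewrite /wbd -sumrN; apply: eq_bigr => x _; rewrite mulrN.
Qed.

Let bd_false (v : gen cone -> S1) y : bd v (y, false) =
  wbd (fun x => v (x, false)) y + v (y, true) * Z -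
  \sum_x v (x, true) * mwiden (N x y).
Proof.
rewrite /bd sum_cone /= -addrA; congr (_ + _).
rewrite (eq_bigr (fun x => v (x, true) * (if x == y then Z else 0) -
   v (x, true) * mwiden (N x y))) => [|x _]; last by rewrite mulrBr.
rewrite sumrB; congr (_ - _); rewrite (bigD1 y) //= eqxx big1 ?addr0 // => x xy.
by rewrite (negPf xy) mulr0.
Qed.

Let sum_mwiden (I : finType) (G : I -> S) :
  \sum_x mwiden (G x) = mwiden (\sum_x G x).
Proof. by rewrite (big_morph _ (@mwidenD n K) (@mwiden0 n K)). Qed.

Let wbd_mw (c : gen C -> S) t y :
  wbd (fun x => mwiden (c x) * Z ^+ t) y = mwiden (bd c y) * Z ^+ t.
Proof.
rewrite /wbd /bd -sum_mwiden mulr_suml; apply: eq_bigr => x _.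
by rewrite mwidenM mulrAC.
Qed.

Let zcoef_wbd t (v : gen C -> S1) y : zcoef t (wbd v y) = bd (fun x => zcoef t (v x)) y.
Proof. by rewrite /wbd /bd raddf_sum; apply: eq_bigr => x _; apply: zcoefMw. Qed.

Let zcoef_N t (v : gen C -> S1) y :
  zcoef t (\sum_x v x * mwiden (N x y)) = \sum_x zcoef t (v x) * N x y.
Proof. by rewrite raddf_sum; apply: eq_bigr => x _; apply: zcoefMw. Qed.

Let av_cone (v : gen cone -> S1) : av f1 v = \sum_x f1 (v (x, false)) * aug C x.
Proof.
rewrite /av sum_cone /= [X in _ + X]big1 ?addr0 // => x _; exact: mulr0.
Qed.

Let cone_dd a c : bd (df cone a) c = 0.
Proof.
have dd x y : wbd (fun z => mwiden (df C x z)) y = 0.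
  have := wbd_mw (df C x) 0 y; rewrite (df_df Cr) mwiden0 mul0r => <-.
  by apply: eq_bigr => z _; rewrite expr0 mulr1.
case: a c => a [] [c []].
- rewrite bd_true /= /wbd (eq_bigr (fun z => - (mwiden (df C a z) * mwiden (df C z c)))).
    by rewrite sumrN opprK; have := dd a c; rewrite /wbd.
  by move=> z _; rewrite mulNr.
- rewrite bd_false /= /wbd.
  rewrite (eq_bigr (fun x => (if a == x then Z * mwiden (df C x c) else 0) -
      mwiden (N a x) * mwiden (df C x c))); last first.
    by move=> x _; rewrite mulrBl; case: eqP => //; rewrite mul0r.
  rewrite sumrB -big_mkcond (big_pred1 a) => [|x]; last by rewrite eq_sym.
  rewrite [X in _ - X + _ - _](eq_bigr (fun x => mwiden (N a x * df C x c))); last first.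
    by move=> x _; rewrite mwidenM.
  rewrite sum_mwiden; have := Nd a c; rewrite /bd => ->.
  rewrite [X in _ - X](eq_bigr (fun x => - mwiden (df C a x * N x c))); last first.
    by move=> x _; rewrite mulNr; rewrite mwidenM.
  by rewrite sumrN sum_mwiden opprK mulNr [Z * _]mulrC addrAC subrK subrr.
- by rewrite bd_true /= /wbd big1 ?oppr0 // => x _; rewrite mul0r.
- rewrite bd_false /= dd mul0r addr0 add0r big1 ?oppr0 // => x _.
  by rewrite mul0r.
Qed.

Let cone_da a : av f1 (df cone a) = 0.
Proof.
rewrite av_cone; case: a => a [] /=; last first.
  rewrite -[RHS](df_aug Cr a).
  by apply: eq_bigr => x _; rewrite f1f.
rewrite (eq_bigr (fun x => (if a == x then f1 Z * aug C x else 0) - f (N a x) * aug C x)).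
  rewrite sumrB -big_mkcond (big_pred1 a) => [|x]; last by rewrite eq_sym.
  by have := Na a; rewrite /av => ->; rewrite subrr.
by move=> x _; rewrite rmorphB f1f mulrBl; case: eqP => //; rewrite rmorph0 mul0r.
Qed.

Let bdB (v w : gen cone -> S1) c : bd (fun b => v b - w b) c = bd v c - bd w c.
Proof. by rewrite bdD bdN. Qed.

(** A cycle may be changed by a boundary before it is shown to be one; [P] records what the change
    has gained. *)
Let reduce (v w : gen cone -> S1) (P : (gen cone -> S1) -> Prop) :
    (forall v', P v' -> (forall c, bd v' c = 0) -> av f1 v' = 0 ->
       exists w', forall c, v' c = bd w' c) ->
    P (fun c => v c - bd w c) -> (forall c, bd v c = 0) -> av f1 v = 0 ->
  exists w', forall c, v c = bd w' c.
Proof.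
move=> IH Pv vd va; have [||w' w'E] := IH _ Pv.
- by move=> c; rewrite bdB vd (bd_bd _ _ cone_dd) subrr.
- by rewrite avD avN va (av_bd w cone_da) subrr.
by exists (fun c => w' c + w c) => c; rewrite bdD -w'E subrK.
Qed.

(* The top coefficients in [Z] form a cycle [c] of [C], and subtracting the boundary
   of [Z ^ e * c], placed in the shifted copy of [C], lowers the degree in [Z]. *)
Let exact_low e (v : gen cone -> S1) :
    (forall x, v (x, true) = 0) ->
    (forall x t, (e < t)%N -> zcoef t (v (x, false)) = 0) ->
    (forall c, bd v c = 0) -> av f1 v = 0 ->
  exists w, forall c, v c = bd w c.
Proof.
elim: e v => [|e IH] v v1 v0 vd va.
  pose c x := zcoef 0 (v (x, false)).
  have vE x : v (x, false) = mwiden (c x).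
    apply/eqP; rewrite -subr_eq0; apply/eqP; apply: zcoef_eq0 => t.
    rewrite raddfB /= -[mwiden (c x)]mulr1 -(expr0 Z) zcoef_wZ.
    by case: t => [|t] /=; rewrite ?subrr // v0 // subr0.
  have [||w wE] := @res_exact _ _ _ _ _ _ _ Cr c.
  - move=> y; have := vd (y, false); rewrite bd_false v1 mul0r addr0.
    rewrite [X in _ - X]big1 => [|x _]; last by rewrite v1 mul0r.
    rewrite subr0 => /(congr1 (zcoef 0)); rewrite zcoef_wbd raddf0 => <-.
    by apply: eq_bigr.
  - by rewrite -va av_cone; apply: eq_bigr => x _; rewrite vE f1f.
  exists (fun x => if x.2 then 0 else mwiden (w x.1)) => -[y []].
    by rewrite bd_true /= v1 /wbd big1 ?oppr0 // => x _; rewrite mul0r.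
  rewrite bd_false /= mul0r addr0 [X in _ - X]big1 => [|x _]; last by rewrite mul0r.
  rewrite subr0 vE wE; have := wbd_mw w 0 y; rewrite expr0 mulr1 => <-.
  by apply: eq_bigr => x _; rewrite mulr1.
pose c x := zcoef e.+1 (v (x, false)).
have bc y : bd c y = 0.
  have := vd (y, false); rewrite bd_false v1 mul0r addr0.
  rewrite [X in _ - X]big1 => [|x _]; last by rewrite v1 mul0r.
  by rewrite subr0 => /(congr1 (zcoef e.+1)); rewrite zcoef_wbd raddf0.
pose w (x : gen cone) := if x.2 then mwiden (c x.1) * Z ^+ e else 0.
pose P (v : gen cone -> S1) := (forall x, v (x, true) = 0) /\
    (forall x t, (e < t)%N -> zcoef t (v (x, false)) = 0).
apply: (@reduce v w P) => // [v' [] /IH H1 /H1 H2|]; first exact: H2.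
split=> [x|x t et].
  by rewrite v1 bd_true /w /= wbd_mw bc mwiden0 mul0r oppr0 subr0.
rewrite bd_false /w /= /wbd big1 ?add0r => [|y _]; last by rewrite mul0r.
rewrite !raddfB /= zcoef_N big1 ?subr0 => [|y _]; last first.
  by rewrite zcoef_wZ gtn_eqF // mul0r.
rewrite -mulrA -exprSr zcoef_wZ; case: eqP => [->|/eqP te]; rewrite !oppr0 !addr0 ?subrr //.
by rewrite v0 // ltn_neqAle eq_sym te.
Qed.

(* The top coefficient in [Z] of the component in the shifted copy of [C] is the
   boundary of a coefficient of the other component. *)
Let cone_exact e (v : gen cone -> S1) :
    (forall x t, (e <= t)%N -> zcoef t (v (x, true)) = 0) ->
    (forall c, bd v c = 0) -> av f1 v = 0 ->
  exists w, forall c, v c = bd w c.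
Proof.
elim: e v => [|e IH] v v1 vd va.
  apply: (@exact_low (\max_(x : gen C) size (muni (v (x, false))))) => //.
    by move=> x; apply: zcoef_eq0 => t; apply: v1.
  move=> x t xt; apply: nth_default; apply: leq_trans (ltnW xt).
  exact: (leq_bigmax (F := fun x => size (muni (v (x, false))))).
pose c x := zcoef e.+1 (v (x, false)).
have bc y : bd c y = - zcoef e (v (y, true)).
  have /(congr1 (zcoef e.+1)) := vd (y, false).
  rewrite bd_false raddfB raddfD /= zcoefMZ zcoef_N zcoef_wbd raddf0.
  rewrite [X in _ - X]big1 => [|x _]; last by rewrite v1 ?mul0r.
  by rewrite subr0 => /eqP; rewrite addr_eq0 => /eqP.
pose w (x : gen cone) := if x.2 then mwiden (c x.1) * Z ^+ e else 0.
pose P (v : gen cone -> S1) := forall x t, (e <= t)%N -> zcoef t (v (x, true)) = 0.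
apply: (@reduce v w P) => // x t et.
rewrite bd_true /w /= wbd_mw bc raddfB raddfN /= zcoef_wZ.
case: eqP => [->|/eqP te]; first by rewrite opprK subrr.
by rewrite oppr0 subr0 v1 // ltn_neqAle eq_sym te.
Qed.

(** Over the larger ring R is the quotient of R[Z] by Z minus the image of Z, and multiplication by
    that difference is injective on R[Z], as leading coefficients in Z show. *)
Lemma cone_res : is_res mf f1 R cone.
Proof.
have mw0 (s : S) : mwiden s != 0 -> s != 0.
  by apply: contraNneq => ->; rewrite mwiden0.
split.
- move=> [a []] [b []] /=; rewrite ?eqxx ?oppr_eq0 ?addn0 ?addn1 //.
  + by move/mw0/(df_hd Cr) ->.
  + case: (eqVneq a b) => [->//|_]; rewrite sub0r oppr_eq0 => /mw0 /Nh [-> //].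
  + by move/mw0/(df_hd Cr) ->.
- move=> [a []] [b []] /=; rewrite ?eqxx ?oppr_eq0 ?addn0 ?addn1 //.
  + move/mw0/(df_homog Cr) => [h1 h2]; split=> //.
    by rewrite dhomogN subSS mwiden_homog.
  + move=> d0; have NE : N a b != 0 -> (dg C b <= (dg C a).+1)%N /\
        mwiden (N a b) \is ((dg C a).+1 - dg C b).-homog.
      by move=> /Nh [_]; rewrite addn1 => h1 h2; split=> //; apply: mwiden_homog.
    have [ab|ab] := eqVneq a b; last first.
      move: d0; rewrite (negPf ab) sub0r oppr_eq0 dhomogN => /mw0 /NE [] //.
    subst b; rewrite leqnSn subSnn; split=> //; apply: dhomogD.
      by rewrite dhomogX /= mdeg1.
    rewrite dhomogN; have [->|/NE [_]] := eqVneq (N a a) 0.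
      by rewrite mwiden0 dhomog0.
    by rewrite subSnn.
  + move/mw0/(df_homog Cr) => [h1 h2]; split=> //.
    by rewrite mwiden_homog.
- by move=> [a []] /=; rewrite ?eqxx // addn0; apply: (aug_hd Cr).
- move=> [a []] /=; first by rewrite dhomog0.
  by rewrite addn0; apply: (aug_homog Cr).
- exact: cone_dd.
- exact: cone_da.
- move=> v; apply: (@cone_exact (\max_(x : gen C) size (muni (v (x, true))))).
  move=> x t xt; apply: nth_default; apply: leq_trans xt.
  exact: (leq_bigmax (F := fun x => size (muni (v (x, true))))).
- have Raug a : R (aug C a).
    apply/(res_img Cr); exists (fun c => (c == a)%:R).
    rewrite /av (bigD1 a) //= eqxx rmorph1 mul1r big1 ?addr0 // => c ca.
    by rewrite (negPf ca) rmorph0 mul0r.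
  have R0 : R 0.
    by apply/(res_img Cr); exists (fun=> 0); rewrite /av big1 // => *; rewrite rmorph0 mul0r.
  move=> u; split=> [/(res_img Cr) [v ->]|[v ->]].
    exists (fun x => mwiden (v x.1)); rewrite av_cone.
    by apply: eq_bigr => x _; rewrite f1f.
  rewrite av_cone; elim/big_ind: _ => // x _.
  exact: RM.
Qed.

End Cone.

(** * Towers of variables and change of coordinates *)

Section Substitution.
Context (K : fieldType).

Definition subst_mpoly n k (h : 'I_n -> {mpoly K[k]}) (p : {mpoly K[n]}) : {mpoly K[k]} :=
  mmap (@mpolyC k K) h p.

HB.instance Definition _ n k (h : 'I_n -> {mpoly K[k]}) :=
  GRing.RMorphism.copy (subst_mpoly h) (mmap (@mpolyC k K) h).

Lemma subst_mpolyC n k (h : 'I_n -> {mpoly K[k]}) c : subst_mpoly h c%:MP = c%:MP.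
Proof. exact: mmapC. Qed.

Lemma subst_mpolyXU n k (h : 'I_n -> {mpoly K[k]}) i : subst_mpoly h 'X_i = h i.
Proof. by rewrite /subst_mpoly mmapX mmap1U. Qed.

Lemma subst_mpolyX n k (h : 'I_n -> {mpoly K[k]}) m :
  subst_mpoly h 'X_[m] = \prod_i h i ^+ m i.
Proof. exact: mmapX. Qed.

Lemma subst_mpolyZ n k (h : 'I_n -> {mpoly K[k]}) c p :
  subst_mpoly h (c *: p) = c *: subst_mpoly h p.
Proof. by rewrite -mul_mpolyC rmorphM /= [subst_mpoly _ _%:MP]subst_mpolyC mul_mpolyC. Qed.

Lemma rmorph_mpoly_eq n (A : comNzRingType) (f g : {rmorphism {mpoly K[n]} -> A}) :
  (forall c, f c%:MP = g c%:MP) -> (forall i, f 'X_i = g 'X_i) -> f =1 g.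
Proof.
move=> fgC fgX p; rewrite [p]mpolyE !rmorph_sum; apply: eq_bigr => m _.
rewrite -mul_mpolyC !rmorphM fgC mpolyXE_id !rmorph_prod; congr (_ * _).
by apply: eq_bigr => i _; rewrite !rmorphXn fgX.
Qed.

Lemma mpolyC_homog n (mf : measure n) (c : K) : c%:MP_[n] \is 0.-homog for mf.
Proof. by rewrite dhomogE msuppC; case: ifP => //= _; rewrite mf0. Qed.

Lemma subst_mpoly_homog n k (mf : measure k) (h : 'I_n -> {mpoly K[k]}) :
    (forall i, h i \is 1.-homog for mf) ->
  forall d p, p \is d.-homog -> subst_mpoly h p \is d.-homog for mf.
Proof.
move=> hh; apply: rmorph_homog => [c|i] /=; last by rewrite subst_mpolyXU.
by rewrite subst_mpolyC mpolyC_homog.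
Qed.

(** The values are indexed by [nat] so that one sequence [h] serves every stage of the tower. *)
Lemma subst_mpoly_mwiden n k (h : nat -> {mpoly K[k]}) (s : {mpoly K[n]}) :
  subst_mpoly (fun i : 'I_n.+1 => h i) (mwiden s) = subst_mpoly (fun i : 'I_n => h i) s.
Proof.
have -> : subst_mpoly (fun i : 'I_n.+1 => h i) (mwiden s) =
  (subst_mpoly (fun i : 'I_n.+1 => h i) \o @mwiden n K) s by [].
apply: rmorph_mpoly_eq => [c|i] /=.
  by rewrite mwidenC !subst_mpolyC.
by rewrite mwidenX mnmwiden1 !subst_mpolyXU.
Qed.

End Substitution.

Section Tower.
Context (K : fieldType) (k : nat) (mf : measure k).
Local Notation U := {mpoly K[k]}.
Context (h : nat -> U) (R : U -> Prop).
Hypothesis hh : forall i, h i \is 1.-homog for mf.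
Hypothesis RD : forall x y, R x -> R y -> R (x + y).
Local Notation rho n := (subst_mpoly (fun i : 'I_n => h i)).
Hypothesis RM : forall n (s : {mpoly K[n]}) x, R x -> R (rho n s * x).

(** The start is a free module in homological degree 0. In each cone the second copy is shifted by
    one in both gradings, so [dg - hd] stays at most [r], and the shifted copy of the corner
    generator is the next corner. *)
Lemma tower_res d r (C : bcx K d k) : is_res mf (rho d) R C ->
    (forall b, hd C b = 0%N /\ (dg C b <= r)%N) -> (exists b, dg C b = r) ->
  forall m, exists C' : bcx K (m + d) k, [/\ is_res mf (rho (m + d)) R C',
    forall b, (hd C' b <= m)%N /\ (dg C' b <= hd C' b + r)%N &
    exists b, hd C' b = m /\ dg C' b = (m + r)%N].
Proof.
move=> Cr Chd [b0 b0r]; elim=> [|m [C1 [C1r C1b [b1 [b1h b1d]]]]].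
  exists C; split=> // [b|]; first by have [-> ->] := Chd b.
  by exists b0; rewrite b0r (Chd b0).1.
have hg := subst_mpoly_homog (fun i : 'I_(m + d) => hh i).
have [x|N [Nh Nd Na]] := chain_lift hg C1r C1r (hh (m + d)).
- by move=> Rx; rewrite -(subst_mpolyXU (fun i : 'I_(m + d).+1 => h i) ord_max); apply: RM.
have f1f := @subst_mpoly_mwiden K (m + d) k h.
exists (cone N); split.
- apply: (@cone_res _ _ _ _ _ _ _ f1f _ C1r N Nh Nd _ RD) => [b|s x]; last exact: RM.
  rewrite Na; congr (_ * _).
  exact: (esym (subst_mpolyXU (fun i : 'I_(m + d).+1 => h i) ord_max)).
- case=> b [] /=; have [h1 h2] := C1b b.
    by rewrite !addn1 ltnS h1 addSn ltnS.
  by rewrite !addn0 h2 (leq_trans h1).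
- by exists (b1, true); rewrite /= b1h b1d !addn1 addSn.
Qed.

End Tower.

Section Transport.
Context (K : fieldType) (k : nat) (mf : measure k) (n n' : nat).
Local Notation U := {mpoly K[k]}.
Context (phi : {rmorphism {mpoly K[n']} -> {mpoly K[n]}}).
Context (psi : {rmorphism {mpoly K[n]} -> {mpoly K[n']}}).
Hypothesis phiK : cancel phi psi.
Hypothesis psiK : cancel psi phi.
Hypothesis phih : forall d p, p \is d.-homog -> phi p \is d.-homog.
Context (f' : {mpoly K[n']} -> U) (f : {mpoly K[n]} -> U) (R : U -> Prop).
Hypothesis ff : forall s, f' s = f (phi s).

Definition map_bcx (C : bcx K n' k) : bcx K n k :=
  @Bcx K n k (gen C) (hd C) (dg C) (fun a b => phi (df C a b)) (aug C).

(** An isomorphism of polynomial rings carries the complex across, which avoids casts along an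
    equality of the numbers of variables. *)
Lemma map_bcx_res C : is_res mf f' R C -> is_res mf f R (map_bcx C).
Proof.
move=> Cr; have phi0 s : phi s != 0 -> s != 0.
  by apply: contraNneq => ->; rewrite rmorph0.
have bdE (v : gen C -> {mpoly K[n]}) c :
    bd (v : gen (map_bcx C) -> _) c = phi (bd (fun b => psi (v b)) c).
  by rewrite /bd rmorph_sum; apply: eq_bigr => b _; rewrite rmorphM psiK.
split=> /=.
- by move=> a b /phi0; apply: (df_hd Cr).
- by move=> a b /phi0 /(df_homog Cr) [h1 h2]; split=> //; apply: phih.
- exact: (aug_hd Cr).
- exact: (aug_homog Cr).
- move=> a c; rewrite bdE -[RHS](rmorph0 phi) -(df_df Cr a c); congr (phi _).
  by apply: eq_bigr => b _; rewrite phiK.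
- by move=> a; rewrite -(df_aug Cr a); apply: eq_bigr => b _; rewrite ff.
- move=> v vd va; have [||w wE] := @res_exact _ _ _ _ _ _ _ Cr (fun b => psi (v b)).
  + by move=> c; apply: (can_inj phiK); rewrite rmorph0 -bdE vd.
  + by rewrite -va; apply: eq_bigr => b _; rewrite ff psiK.
  exists (fun b => phi (w b)) => c; rewrite bdE -[LHS]psiK wE; congr (phi _).
  by apply: eq_bigr => b _; rewrite phiK.
- move=> u; split=> [/(res_img Cr)|] [v ->].
    by exists (fun b => phi (v b)); apply: eq_bigr => b _; rewrite ff.
  apply/(res_img Cr); exists (fun b => psi (v b)).
  by apply: eq_bigr => b _; rewrite ff psiK.
Qed.

End Transport.

(** * The toric presentation of the Hibi ring *)

Section Toric.
Context (K : fieldType) (disp : Order.disp_t) (T : finPOrderType disp).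
Local Notation n := #|{: ideal T}|.
Local Notation k := #|{: option T}|.
Local Notation S := {mpoly K[n]}.
Local Notation U := {mpoly K[k]}.

(* The monomial [t * \prod_(x in J) X_x], the variable [t] being indexed by [None]. *)
Definition tmon (J : {set T}) : 'X_{1..k} :=
  [multinom nat_of_bool (if enum_val i is Some x then x \in J else true) | i < k].

Definition ev (u : 'X_{1..k}) (y : option T) : nat := u (enum_rank y).

Lemma evD u v y : ev (u + v)%MM y = (ev u y + ev v y)%N.
Proof. exact: mnmDE. Qed.

Lemma ev_tmon J y : ev (tmon J) y = if y is Some x then x \in J else true.
Proof. by rewrite /ev mnmE enum_rankK; case: y. Qed.

Lemma ev_inj u v : ev u =1 ev v -> u = v.
Proof. by move=> uv; apply/mnmP => i; rewrite -[i]enum_valK; apply: uv. Qed.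

Definition imon (i : 'I_n) : 'X_{1..k} := tmon (val (enum_val i)).

Definition tau (m : 'X_{1..n}) : 'X_{1..k} := (\sum_(i < n) imon i *+ m i)%MM.

Definition toric : {rmorphism S -> U} := subst_mpoly (fun i => 'X_[imon i]).

Lemma toricX m : toric 'X_[m] = 'X_[tau m].
Proof. by rewrite /toric /= subst_mpolyX mprodXnE. Qed.

Lemma toricZ c p : toric (c *: p) = c *: toric p.
Proof. exact: subst_mpolyZ. Qed.

Lemma tauD m1 m2 : tau (m1 + m2)%MM = (tau m1 + tau m2)%MM.
Proof.
rewrite /tau -big_split /=; apply: eq_bigr => i _; apply/mnmP => j.
by rewrite mulmnE !mnmDE !mulmnE mulnDr.
Qed.

Lemma tauU a : tau U_(enum_rank a)%MM = tmon (val a).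
Proof.
rewrite /tau (bigD1 (enum_rank a)) //= big1 => [|i ia].
  by rewrite mnm1E eqxx mulm1n addm0 /imon enum_rankK.
by rewrite mnm1E eq_sym (negPf ia) mulm0n.
Qed.

Lemma ev_tau m y : ev (tau m) y = (\sum_(i < n) (if y is Some x then
  nat_of_bool (x \in val (enum_val i)) else 1%N) * m i)%N.
Proof.
rewrite /ev /tau mnm_sumE; apply: eq_bigr => i _; rewrite mulmnE.
by have := ev_tmon (val (enum_val i)) y; rewrite /ev => ->; case: y.
Qed.

Lemma ev_tau_None m : ev (tau m) None = mdeg m.
Proof. by rewrite ev_tau mdegE; apply: eq_bigr => i _; rewrite mul1n. Qed.

(** The exponent of t. Every generator of the toric ring contains t exactly once, so this grading
    restricts to the standard grading of R. *)
Definition tdeg (u : 'X_{1..k}) : nat := ev u None.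

Lemma tdeg0 : tdeg 0%MM = 0%N. Proof. exact: mnm0E. Qed.

Lemma tdegD : {morph tdeg : u v / (u + v)%MM >-> (u + v)%N}.
Proof. by move=> u v; apply: evD. Qed.

HB.instance Definition _ := isMeasure.Build k tdeg tdeg0 tdegD.

Lemma toric_homog d p : p \is d.-homog -> toric p \is d.-homog for tdeg.
Proof.
apply: subst_mpoly_homog => i; rewrite dhomogX /=.
by rewrite /tdeg ev_tmon.
Qed.

Lemma varLE (a : ideal T) : varL K (val a) = 'X_(enum_rank a).
Proof. by rewrite /varL valK. Qed.

Lemma ideal_le (a : ideal T) x y : (y <= x)%O -> x \in val a -> y \in val a.
Proof.
move=> yx xa; have /forallP/(_ x)/forallP/(_ y)/implyP := valP a.
by apply; rewrite yx.
Qed.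

Lemma is_poset_idealP (A : {set T}) :
  (forall x y, (y <= x)%O -> x \in A -> y \in A) -> is_poset_ideal A.
Proof.
move=> Ale; apply/forallP => x; apply/forallP => y; apply/implyP => /andP [yx].
exact: Ale.
Qed.

Lemma ideal_setU_subproof (a b : ideal T) : is_poset_ideal (val a :|: val b).
Proof.
apply: is_poset_idealP => x y yx; rewrite !inE.
by case/orP => /(ideal_le yx) ->; rewrite ?orbT.
Qed.

Lemma ideal_setI_subproof (a b : ideal T) : is_poset_ideal (val a :&: val b).
Proof.
apply: is_poset_idealP => x y yx; rewrite !inE.
by case/andP => /(ideal_le yx) -> /(ideal_le yx) ->.
Qed.

Definition idealU a b : ideal T := Sub (val a :|: val b) (ideal_setU_subproof a b).
Definition idealI a b : ideal T := Sub (val a :&: val b) (ideal_setI_subproof a b).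

Local Notation X a := ('X_(enum_rank a) : S).

Lemma hibi_genE (a b : ideal T) :
  hibi_gen K a b = X a * X b - X (idealU a b) * X (idealI a b).
Proof. by rewrite -!varLE. Qed.

Lemma hibi0 : in_hibi_ideal (0 : S).
Proof. by exists (fun=> 0); rewrite big1 // => ab _; rewrite mul0r. Qed.

Lemma hibiD (p q : S) : in_hibi_ideal p -> in_hibi_ideal q -> in_hibi_ideal (p + q).
Proof.
move=> [g ->] [h ->]; exists (fun ab => g ab + h ab).
by rewrite -big_split; apply: eq_bigr => ab _; rewrite mulrDl.
Qed.

Lemma hibiM (s p : S) : in_hibi_ideal p -> in_hibi_ideal (s * p).
Proof.
move=> [g ->]; exists (fun ab => s * g ab).
by rewrite mulr_sumr; apply: eq_bigr => ab _; rewrite mulrA.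
Qed.

Lemma hibiN (p : S) : in_hibi_ideal p -> in_hibi_ideal (- p).
Proof. by move=> hp; rewrite -mulN1r; apply: hibiM. Qed.

Lemma hibi_trans (p q r : S) :
  in_hibi_ideal (p - q) -> in_hibi_ideal (q - r) -> in_hibi_ideal (p - r).
Proof. by move=> h1 h2; have := hibiD h1 h2; rewrite addrA subrK. Qed.

Lemma hibi_gen_in (a b : ideal T) :
  in_hibi_ideal (X a * X b - X (idealU a b) * X (idealI a b)).
Proof.
have [iab|] := boolP (incomparable_ideals a b).
  exists (fun ab => (ab == (a, b))%:R); rewrite (bigD1 (a, b)) //= eqxx mul1r.
  by rewrite big1 ?addr0 ?hibi_genE // => ab /andP [_ /negPf ->]; rewrite mul0r.
rewrite negb_and !negbK => /orP [ab|ba].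
  have -> : idealU a b = b by apply: val_inj; rewrite /= (setUidPr ab).
  have -> : idealI a b = a by apply: val_inj; rewrite /= (setIidPl ab).
  by rewrite mulrC subrr; apply: hibi0.
have -> : idealU a b = a by apply: val_inj; rewrite /= (setUidPl ba).
have -> : idealI a b = b by apply: val_inj; rewrite /= (setIidPr ba).
by rewrite subrr; apply: hibi0.
Qed.

Lemma toric_hibi q : in_hibi_ideal q -> toric q = 0.
Proof.
move=> [g ->]; rewrite rmorph_sum big1 // => -[a b] _.
rewrite rmorphM hibi_genE rmorphB !rmorphM !toricX !tauU -!mpolyXD.
have -> : (tmon (val a) + tmon (val b) =
    tmon (val (idealU a b)) + tmon (val (idealI a b)))%MM.
  apply: ev_inj => y; rewrite !evD !ev_tmon; case: y => //= x.
  by rewrite !inE; case: (x \in _); case: (x \in _).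
by rewrite subrr mulr0.
Qed.

(* Multiplying the variables of a monomial one after the other collects the
   union of all its ideals in a single variable. *)
Lemma hibi_top d (m : 'X_{1..n}) : mdeg m = d.+1 ->
  exists (a : ideal T) (m2 : 'X_{1..n}), [/\ mdeg m2 = d,
  forall x, (x \in val a) = (0 < ev (tau m) (Some x))%N &
  in_hibi_ideal ('X_[m] - X a * 'X_[m2] : S)].
Proof.
elim: d m => [|d IH] m md.
  have /mdeg1P [i /eqP mi] : mdeg m == 1%N by rewrite md.
  exists (enum_val i), 0%MM; rewrite mdeg0 mpolyX0 mulr1 enum_valK -mi subrr.
  split=> // [x|]; last exact: hibi0.
  by rewrite mi -{2}[i]enum_valK tauU ev_tmon; case: (_ \in _).
have [i mi] : exists i, (0 < m i)%N.
  apply/existsP; apply: contraT; rewrite negb_exists => /forallP m0.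
  by move: md; rewrite mdegE big1 // => i _; apply/eqP; rewrite -leqn0 leqNgt.
pose m1 := (m - U_(i))%MM.
have mE : m = (U_(i) + m1)%MM by rewrite addmC submK // lep1mP -lt0n.
have [|a [m2 [m2d aE hm1]]] := IH m1.
  by move: md; rewrite mE mdegD mdeg1 add1n => -[].
pose b := enum_val i; have iE : i = enum_rank b by rewrite enum_valK.
exists (idealU b a), (U_(enum_rank (idealI b a)) + m2)%MM; split.
- by rewrite mdegD mdeg1 m2d.
- move=> x; rewrite inE mE tauD evD iE tauU ev_tmon aE /=.
  by case: (x \in _).
- rewrite mE mpolyXD {1}iE; apply: (@hibi_trans _ (X b * (X a * 'X_[m2]))).
    by rewrite -mulrBr; apply: hibiM.
  rewrite mpolyXD !mulrA -mulrBl mulrC; apply: hibiM; exact: hibi_gen_in.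
Qed.

Lemma mpolyX_inj (m1 m2 : 'X_{1..k}) : 'X_[m1] = 'X_[m2] :> U -> m1 = m2.
Proof.
move/(congr1 (fun p => p@_m1)); rewrite !mcoeffX eqxx; case: eqP => [->//|_] /eqP.
by rewrite oner_eq0.
Qed.

(** The ideal split off by [hibi_top] is the support of the exponents in [tau m], hence the same for
    [m] and [m']. The common variable is cancelled and the degree drops. *)
Lemma hibi_tau m m' : tau m = tau m' -> in_hibi_ideal ('X_[m] - 'X_[m'] : S).
Proof.
have [d] := ubnP (mdeg m); elim: d m m' => // d IH m m'; rewrite ltnS => md mm'.
have dd : mdeg m = mdeg m' by rewrite -!ev_tau_None mm'.
case e: (mdeg m) => [|d'].
  have /eqP m0 := e; rewrite dd mdeg_eq0 in m0; rewrite (eqP m0).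
  by move/eqP: e; rewrite mdeg_eq0 => /eqP ->; rewrite subrr; apply: hibi0.
have [a [m2 [m2d aE h1]]] := hibi_top e.
have [a' [m2' [m2d' aE' h2]]] := hibi_top (etrans (esym dd) e).
have aa : a = a' by apply/val_inj/setP => x; rewrite aE aE' mm'.
have tE m0 m20 : in_hibi_ideal ('X_[m0] - X a * 'X_[m20] : S) ->
    tau m0 = (tmon (val a) + tau m20)%MM.
  move/toric_hibi/eqP; rewrite rmorphB rmorphM !toricX tauU -mpolyXD subr_eq0.
  by move/eqP/mpolyX_inj.
rewrite -aa in h2; apply: (hibi_trans h1).
apply: (@hibi_trans _ (X a * 'X_[m2'])); last by rewrite -opprB; apply: hibiN.
rewrite -mulrBr; apply/hibiM/IH; first by rewrite m2d -ltnS -e ltnS.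
by apply: (@addmI _ (tmon (val a))); rewrite -(tE _ _ h1) -(tE _ _ h2).
Qed.

(** If the image vanishes, any monomial [m] of [q] shares its image with another monomial [m'] of
    [q]. Subtracting a multiple of their difference removes [m] and introduces no new monomial, so
    the support shrinks. *)
Lemma ker_toric q : in_hibi_ideal q <-> toric q = 0.
Proof.
split=> [|q0]; first exact: toric_hibi.
have [d] := ubnP (size (msupp q)); elim: d q q0 => // d IH q q0; rewrite ltnS => qd.
have [->|/mlead_supp] := eqVneq q 0; first exact: hibi0.
move: (mlead q) => m mq.
have [m' m'q /andP [m'm tm]] : exists2 m', m' \in msupp q & (m' != m) && (tau m' == tau m).
  apply/hasP; apply: contraT => /hasPn nm.
  have /eqP : (toric q)@_(tau m) = 0 by rewrite q0 mcoeff0.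
  rewrite {1}[q]mpolyE rmorph_sum raddf_sum /= (bigD1_seq m) ?msupp_uniq //=.
  rewrite [subst_mpoly _ _]toricZ mcoeffZ toricX mcoeffX eqxx mulr1.
  rewrite big_seq_cond big1 ?addr0 => [|m' /andP [m'q m'm]].
    by move: mq; rewrite mcoeff_msupp => /negPf ->.
  rewrite [subst_mpoly _ _]toricZ mcoeffZ toricX mcoeffX.
  by have := nm _ m'q; rewrite m'm /= => /negPf ->; rewrite mulr0.
pose r : S := q@_m *: ('X_[m] - 'X_[m']).
have hr : in_hibi_ideal r.
  by rewrite /r -mul_mpolyC; apply/hibiM/hibi_tau; rewrite (eqP tm).
rewrite -[q](subrK r); apply: hibiD => //; apply: IH.
  by rewrite rmorphB q0 (toric_hibi hr) subr0.
have lt_m : (size (rem m (msupp q)) < size (msupp q))%N.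
  by rewrite size_rem // prednK // lt0n size_eq0; apply: contraTneq mq => ->.
apply: leq_trans qd; apply: leq_ltn_trans lt_m.
apply: uniq_leq_size (msupp_uniq _) _ => x; rewrite mcoeff_msupp => xr.
rewrite mem_rem_uniq ?msupp_uniq // inE; apply/andP; split.
  apply: contraNneq xr => ->; rewrite mcoeffB mcoeffZ mcoeffB !mcoeffX eqxx.
  by rewrite (negPf m'm) subr0 mulr1 subrr.
rewrite mcoeff_msupp; apply: contraNneq xr => x0.
rewrite mcoeffB x0 mcoeffZ mcoeffB !mcoeffX.
have /negPf -> : m != x by apply: contraTneq mq => ->; rewrite mcoeff_msupp x0 eqxx.
have /negPf -> : m' != x by apply: contraTneq m'q => ->; rewrite mcoeff_msupp x0 eqxx.
by rewrite subrr mulr0 subr0.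
Qed.

End Toric.

Local Close Scope ring_scope.

(** * Linear extensions and descents *)

Section LinearExtensions.
Context (disp : Order.disp_t) (T : finPOrderType disp).
Local Notation p := #|T|.

(** A natural labelling: the size of the principal ideal makes it strictly increasing along P, and
    the enumeration rank, a last digit in base [p], makes it injective. *)
Definition label (x : T) : nat := #|[set y : T | (y <= x)%O]| * p + enum_rank x.

Lemma label_inj : injective label.
Proof.
move=> x y /(congr1 (modn^~ p)); rewrite /label !modnMDl !modn_small ?ltn_ord //.
by move/val_inj/enum_rank_inj.
Qed.

Lemma label_lt x y : (x < y)%O -> label x < label y.
Proof.
move=> xy; rewrite /label; have lt : #|[set z : T | (z <= x)%O]| < #|[set z : T | (z <= y)%O]|.
  apply: proper_card; apply/properP; split.
    by apply/subsetP => z; rewrite !inE => /le_trans; apply; apply: ltW.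
  by exists y; rewrite !inE ?lexx // lt_geF.
apply: (@leq_trans (#|[set z : T | (z <= x)%O]|.+1 * p)).
  by rewrite mulSn addnC ltn_add2r ltn_ord.
by apply: leq_trans (leq_addr _ _); rewrite leq_mul2r lt orbT.
Qed.

Definition linext (w : {ffun T -> 'I_p}) : bool :=
  injectiveb w && [forall x, forall y, (x < y)%O ==> (w x < w y)].

Definition lext := {w : {ffun T -> 'I_p} | linext w}.

Definition pos (w : lext) (x : T) : nat := val w x.

Lemma pos_inj w : injective (pos w).
Proof. by have /andP [/injectiveP wi _] := valP w; move=> x y /val_inj /wi. Qed.

Lemma pos_lt w x y : (x < y)%O -> pos w x < pos w y.
Proof.
by have /andP [_ /forallP/(_ x)/forallP/(_ y)/implyP] := valP w; apply.
Qed.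

Lemma pos_surj w i : i < p -> exists x, pos w x = i.
Proof.
move=> ip; have /andP [/injectiveP wi _] := valP w.
have [g _ gK] : bijective (val w) by apply: inj_card_bij => //; rewrite card_ord.
by exists (g (Ordinal ip)); rewrite /pos gK.
Qed.

Lemma pos_ltp w x : pos w x < p. Proof. exact: ltn_ord. Qed.

Definition flag (w : lext) (i : nat) : {set T} := [set x | pos w x < i].

Lemma card_flag w i : i <= p -> #|flag w i| = i.
Proof.
move=> ip; have /andP [/injectiveP wi _] := valP w.
have widi : injective (widen_ord ip) by move=> a b /(congr1 val) /= /val_inj.
rewrite -(card_imset _ wi) -[RHS]card_ord -(card_imset _ widi).
apply: eq_card => j; apply/imsetP/imsetP => [[x]|[j' _ ->]].
  rewrite inE => xi ->; exists (Ordinal xi) => //; exact: val_inj.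
have [x xj] := pos_surj w (leq_trans (ltn_ord j') ip).
by exists x; [rewrite inE xj | apply: val_inj; rewrite /= -xj].
Qed.

Lemma flag_ideal w i : is_poset_ideal (flag w i).
Proof.
apply: is_poset_idealP => x y yx; rewrite !inE; apply: leq_ltn_trans.
by move: yx; rewrite le_eqVlt => /orP [/eqP -> //|/(pos_lt w)/ltnW].
Qed.

Definition iflag w i : ideal T := Sub (flag w i) (flag_ideal w i).

Lemma flag_initial w (A : {set T}) :
  (forall x y, x \in A -> pos w y < pos w x -> y \in A) -> A = flag w #|A|.
Proof.
move=> Ai; apply/eqP; rewrite eqEcard card_flag ?max_card // leqnn andbT.
apply/subsetP => x xA; rewrite inE.
rewrite -(@card_flag w (pos w x).+1) ?pos_ltp //; apply: subset_leq_card.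
apply/subsetP => y; rewrite inE ltnS leq_eqVlt => /orP [/eqP/pos_inj -> //|].
exact: Ai.
Qed.

Lemma flagS w i j : i <= j -> flag w i \subset flag w j.
Proof. by move=> ij; apply/subsetP => x; rewrite !inE => /leq_trans; apply. Qed.

Definition des (w : lext) (i : nat) : bool :=
  [exists x, exists y, [&& (pos w x).+1 == i, pos w y == i & label y < label x]].

Lemma label_asc w x y : pos w x < pos w y ->
  (forall i, pos w x < i <= pos w y -> ~~ des w i) -> label x < label y.
Proof.
have [d] := ubnP (pos w y - pos w x); elim: d x y => // d IH x y; rewrite ltnS => dxy xy nd.
have y0 : 0 < pos w y by apply: leq_ltn_trans xy.
have [z zy] : exists z, pos w z = (pos w y).-1.
  by apply: pos_surj; rewrite prednK // ltnW // pos_ltp.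
have zy1 : (pos w z).+1 = pos w y by rewrite zy prednK.
have lzy : label z < label y.
  have := nd (pos w y); rewrite xy leqnn => /(_ isT); apply: contraNT.
  rewrite -leqNgt leq_eqVlt => /orP [/eqP/label_inj yz|lyz].
    by move/eqP: zy1; rewrite yz eqn_leq ltnn.
  by apply/existsP; exists z; apply/existsP; exists y; rewrite zy1 !eqxx.
have [xz|xz] := eqVneq x z; first by rewrite xz.
have ltxz : pos w x < pos w z.
  rewrite ltn_neqAle -ltnS zy1 xy andbT; apply: contraNneq xz => /pos_inj ->.
  by rewrite eqxx.
apply: ltn_trans lzy; apply: IH => // [|i /andP [xi iz]].
  by apply: leq_trans dxy; rewrite ltn_sub2r // -zy1.
by apply: nd; rewrite xi (leq_trans iz) // -zy1.
Qed.

Lemma pos_card w x : pos w x = #|[set y | pos w y < pos w x]|.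
Proof. by rewrite -/(flag w (pos w x)) card_flag // ltnW // pos_ltp. Qed.

Lemma lext_eq w w' :
  (forall x y, pos w x < pos w y -> pos w' x < pos w' y) -> w = w'.
Proof.
move=> ww'; apply/val_inj/ffunP => x; apply: val_inj.
change (pos w x = pos w' x); rewrite (pos_card w) (pos_card w'); apply: eq_card => y; rewrite !inE.
apply/idP/idP => [|y'x]; first exact: ww'.
rewrite ltnNge leq_eqVlt; apply/negP => /orP [/eqP/pos_inj E|/ww'].
  by rewrite E ltnn in y'x.
by rewrite ltnNge (ltnW y'x).
Qed.

Lemma lext_of_key (key : T -> nat) : injective key ->
    (forall x y, (x < y)%O -> key x < key y) ->
  exists w : lext, forall x y, (pos w x < pos w y) = (key x < key y).
Proof.
move=> ki km; pose below x := [set y | key y < key x].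
have bp x : #|below x| < p.
  rewrite -cardsT; apply: proper_card; apply/properP; split; first exact: subsetT.
  by exists x; rewrite !inE ?ltnn.
pose w := [ffun x => Ordinal (bp x)].
have wlt x y : key x < key y -> (w x < w y)%N.
  rewrite !ffunE /= => xy; apply: proper_card; apply/properP; split.
    by apply/subsetP => z; rewrite !inE => /ltn_trans; apply.
  by exists x; rewrite !inE ?ltnn.
have wle x y : (w x < w y)%N = (key x < key y).
  apply/idP/idP => [|/wlt //]; apply: contraTT; rewrite -!leqNgt leq_eqVlt.
  by case/orP => [/eqP/ki -> //|/wlt/ltnW].
have lw : linext w.
  apply/andP; split; last first.
    by apply/forallP => x; apply/forallP => y; apply/implyP => /km /wlt.
  apply/injectiveP => x y xy; apply: ki; apply/eqP.
  by rewrite eqn_leq (leqNgt (key x)) (leqNgt (key y)) -!wle xy ltnn.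
by exists (Sub w lw).
Qed.

Definition ndes (w : lext) : nat := \sum_(i < p.+1) des w i.

(** Neither the empty ideal nor the whole poset separates two elements, so only the indices from 1
    to [p - 1] can be descents. *)
Lemma ndes_le w : ndes w <= p - 1.
Proof.
rewrite /ndes -(big_mkord xpredT (fun i => nat_of_bool (des w i))) big_nat_recr //=.
have -> : des w p = false.
  apply/existsPn => x; apply/existsPn => y; apply/negP => /and3P [_ /eqP E _].
  by have := pos_ltp w y; rewrite E ltnn.
rewrite addn0; case: (posnP p) => [->|p0]; first by rewrite big_nil.
rewrite big_ltn //; have -> : des w 0 = false.
  by apply/existsPn => x; apply/existsPn => y.
rewrite add0n; apply: (@leq_trans (\sum_(1 <= i < p) 1)).
  by apply: leq_sum => i _; case: des.
by rewrite sum_nat_const_nat muln1.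
Qed.

Lemma antichain_ndes (Q : {set T}) : antichain Q -> exists w, #|Q| - 1 <= ndes w.
Proof.
move=> Qa; have Qlt x y : x \in Q -> y \in Q -> (x < y)%O -> False.
  move=> xQ yQ xy; have /forallP/(_ x) := Qa; rewrite xQ => /forallP/(_ y).
  by rewrite yQ (lt_eqF xy) /= /Order.comparable (ltW xy).
pose C := \max_x label x; have labC x : label x <= C by apply: leq_bigmax.
(* Elements strictly below [Q] come first, then [Q], then the rest; since [Q] is an antichain this
   respects the order. Inside [Q] the labels are reversed, and the factor [C.+1] in [key] makes the
   comparison lexicographic. *)
pose zone x : nat := if x \in Q then 1 else if [exists q in Q, (x < q)%O] then 0 else 2.
pose inner x := if x \in Q then C - label x else label x.
have innerC x : inner x < C.+1 by rewrite /inner ltnS; case: ifP => _; rewrite ?leq_subr.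
pose key x := zone x * C.+1 + inner x.
have zoneQ x : (x \in Q) = (zone x == 1).
  by rewrite /zone; case: ifP => //; case: ifP.
have key_zone x y : key x <= key y -> zone x <= zone y.
  rewrite -ltnS => xy; rewrite -ltnS -(ltn_pmul2r (ltn0Sn C)).
  apply: leq_ltn_trans (leq_addr (inner x) _) _; apply: leq_trans xy _.
  by rewrite /key -addnS mulSn addnC leq_add2r innerC.
have key_lt x y : zone x <= zone y -> (zone x = zone y -> inner x < inner y) -> key x < key y.
  rewrite leq_eqVlt => /orP [/eqP E /(_ E) lt|lt _].
    by rewrite /key E ltn_add2l.
  apply: leq_trans (leq_addr _ _); apply: (@leq_trans ((zone x).+1 * C.+1)).
    by rewrite /key mulSn addnC ltn_add2r innerC.
  by rewrite leq_mul2r lt orbT.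
have ki : injective key.
  move=> x y xy; have zz : zone x = zone y.
    by apply/eqP; rewrite eqn_leq !key_zone ?xy.
  move: xy; rewrite /key zz => /addnI; rewrite /inner !zoneQ zz.
  case: ifP => _; last exact: label_inj.
  move=> E; apply: label_inj; rewrite -(subKn (labC x)) -(subKn (labC y)) E //.
have [x y xy|w wk] := lext_of_key ki.
  have lxy := label_lt xy.
  apply: key_lt.
    rewrite /zone; case: ifP => xQ.
      case: (boolP (y \in Q)) => // yQ.
      case: (boolP [exists q in Q, (y < q)%O]) => // /existsP [q /andP [qQ yq]].
      by case: (Qlt x q xQ qQ (lt_trans xy yq)).
    case: (boolP [exists q in Q, (x < q)%O]) => // /negP xq.
    case: (boolP (y \in Q)) => yQ.
      by case: xq; apply/existsP; exists y; rewrite yQ.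
    case: (boolP [exists q in Q, (y < q)%O]) => // /existsP [q /andP [qQ yq]].
    by case: xq; apply/existsP; exists q; rewrite qQ (lt_trans xy yq).
  move=> zz; rewrite /inner !zoneQ zz; case: ifP => // /eqP zy.
  by case: (Qlt x y); rewrite ?zoneQ ?zz ?zy.
exists w; case: (set_0Vmem Q) => [->|[q0 q0Q]]; first by rewrite cards0.
pose y0 := [arg min_(y < q0 in Q) pos w y].
have [y0Q y0min] : y0 \in Q /\ forall y, y \in Q -> pos w y0 <= pos w y.
  by rewrite /y0; case: arg_minnP.
rewrite (cardsD1 y0) y0Q addKn /ndes.
rewrite (eq_bigr (fun i : 'I_p.+1 => if des w i then 1 else 0)); last by move=> i _; case: des.
rewrite -big_mkcond sum1_card.
have poso y : pos w y < p.+1 by rewrite ltnS ltnW // pos_ltp.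
rewrite -(card_imset (Q :\ y0) (f := fun y => Ordinal (poso y))); last first.
  by move=> x y [] /pos_inj.
apply: subset_leq_card; apply/subsetP => i /imsetP [y /setD1P [yy0 yQ] ->].
rewrite unfold_in /=; have lty : pos w y0 < pos w y.
  rewrite ltn_neqAle y0min // andbT; apply: contraNneq yy0 => /pos_inj ->.
  exact: eqxx.
have y_gt0 : 0 < pos w y by apply: leq_ltn_trans lty.
have [z zy] : exists z, pos w z = (pos w y).-1.
  by apply: pos_surj; rewrite prednK // ltnW // pos_ltp.
have zy1 : (pos w z).+1 = pos w y by rewrite zy prednK.
have kzy : key z < key y by rewrite -wk -zy1.
(* The predecessor [z] of [y] lies between [y0] and [y], hence in the zone of [Q], where labels
   decrease. So every member of [Q] except the first one is preceded by a descent. *)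
have k0z : key y0 <= key z.
  by rewrite leqNgt -wk -leqNgt -ltnS zy1.
have zQ : z \in Q.
  move: yQ y0Q; rewrite !zoneQ => /eqP z1 /eqP z2.
  by rewrite eqn_leq -{1}z1 -z2 !key_zone // ltnW.
apply/existsP; exists z; apply/existsP; exists y; rewrite zy1 !eqxx /=.
move: kzy; rewrite /key; have /eqP -> : zone z == 1 by rewrite -zoneQ.
have /eqP -> : zone y == 1 by rewrite -zoneQ.
rewrite ltn_add2l /inner zQ yQ => lt; rewrite ltnNge; apply/negP => le.
by move: lt; rewrite ltnNge leq_sub2l.
Qed.

Lemma lext_exists : exists w : lext, True.
Proof. by have [|w _] := lext_of_key label_inj; [exact: label_lt | exists w]. Qed.

End LinearExtensions.

(** * A potential on monomials *)

Section Potential.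
Context (disp : Order.disp_t) (T : finPOrderType disp).
Local Notation n := #|{: ideal T}|.
Local Notation k := #|{: option T}|.
Local Notation p := #|T|.

Definition iset (j : 'I_n) : {set T} := val (enum_val j : ideal T).

Definition isize (j : 'I_n) : nat := #|iset j|.

Lemma isize_le j : isize j < p.+1. Proof. exact: max_card. Qed.

Lemma iset_rank (a : ideal T) : iset (enum_rank a) = val a.
Proof. by rewrite /iset enum_rankK. Qed.

Definition rk (m : 'X_{1..n}) (i : nat) : nat := \sum_(j < n | isize j == i) m j.

Lemma rkD m m' i : rk (m + m')%MM i = rk m i + rk m' i.
Proof. by rewrite /rk -big_split; apply: eq_bigr => j _; rewrite mnmDE. Qed.

Lemma rk0 i : rk 0%MM i = 0.
Proof. by rewrite /rk big1 // => j _; rewrite mnm0E. Qed.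

Lemma rkU j i : rk U_(j)%MM i = (isize j == i).
Proof.
rewrite /rk; case: eqP => [ji|ji].
  rewrite (bigD1 j) ?ji //= mnm1E eqxx big1 // => j' /andP [_ jj'].
  by rewrite mnm1E eq_sym (negPf jj').
rewrite big1 // => j' /eqP j'i; rewrite mnm1E; case: eqP => // E.
by case: ji; rewrite E.
Qed.

Lemma rkMn m c i : rk (m *+ c)%MM i = rk m i * c.
Proof. by rewrite /rk big_distrl; apply: eq_bigr => j _; rewrite mulmnE. Qed.

Lemma sum_rk (m : 'X_{1..n}) (G : nat -> nat) :
  \sum_j m j * G (isize j) = \sum_(i < p.+1) rk m i * G i.
Proof.
rewrite (partition_big (fun j => Ordinal (isize_le j)) xpredT) //=.
apply: eq_bigr => i _; rewrite /rk big_distrl; apply: eq_big => [j|j].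
  by rewrite -val_eqE.
by move/eqP <-.
Qed.

Lemma mdeg_rk m : mdeg m = \sum_(i < p.+1) rk m i.
Proof.
rewrite mdegE; transitivity (\sum_(i < p.+1) rk m i * 1); last first.
  by apply: eq_bigr => i _; rewrite muln1.
by rewrite -(sum_rk m (fun=> 1)); apply: eq_bigr => j _; rewrite muln1.
Qed.

Definition lweight (x : T) : nat := (\max_(y : T) label y) - label x.

Lemma lweight_lt x y : label x < label y -> lweight y < lweight x.
Proof. by move=> xy; apply: ltn_sub2l => //; apply: leq_trans (leq_bigmax y). Qed.

Definition sqsum (u : 'X_{1..k}) : nat := \sum_x ev u (Some x) ^ 2.
Definition lwsum (u : 'X_{1..k}) : nat := \sum_x ev u (Some x) * lweight x.
Definition wtot : nat := \sum_x lweight x.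

(* Lexicographic in [(sqsum, lwsum)], since [lwsum u <= tdeg u * wtot]. *)
Definition Phi (u : 'X_{1..k}) : nat := sqsum u * (tdeg u * wtot).+1 + lwsum u.

Lemma lwsum_tau m : lwsum (tau m) = \sum_j m j * \sum_(x in iset j) lweight x.
Proof.
rewrite /lwsum (eq_bigr (fun x => \sum_j m j * ((x \in iset j) * lweight x))); last first.
  move=> x _; rewrite ev_tau big_distrl; apply: eq_bigr => j _ /=.
  by rewrite -/(iset j) mulnAC mulnC.
rewrite exchange_big /=; apply: eq_bigr => j _; rewrite -big_distrr [in RHS]big_mkcond.
by congr (_ * _); apply: eq_bigr => x _; case: (_ \in _); rewrite ?mul1n.
Qed.

(** Each square counts pairs of factors whose ideals both contain [x]. In terms of intersections,
    the bound by the smaller size is attained exactly by comparable ideals, which is why squares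
    detect chains. *)
Lemma sqsum_tau m :
  sqsum (tau m) = \sum_i m i * \sum_j m j * #|iset i :&: iset j|.
Proof.
rewrite /sqsum (eq_bigr (fun x => \sum_i \sum_j
    m i * (m j * ((x \in iset i) && (x \in iset j))))); last first.
  move=> x _; rewrite ev_tau -mulnn big_distrl; apply: eq_bigr => i _ /=.
  rewrite big_distrr; apply: eq_bigr => j _ /=; rewrite -mulnb -/(iset i) -/(iset j).
  by rewrite mulnACA mulnC -mulnA.
rewrite exchange_big /=; apply: eq_bigr => i _; rewrite exchange_big big_distrr /=.
apply: eq_bigr => j _; rewrite -!big_distrr /=; congr (_ * (_ * _)).
rewrite -sum1_card [in RHS]big_mkcond; apply: eq_bigr => x _.
by rewrite inE; case: andP.
Qed.

Lemma lwsum_le m : lwsum (tau m) <= tdeg (tau m) * wtot.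
Proof.
rewrite lwsum_tau /tdeg ev_tau_None mdegE big_distrl; apply: leq_sum => j _ /=.
rewrite leq_mul2l; apply/orP; right; rewrite /wtot big_mkcond.
by apply: leq_sum => x _; case: ifP.
Qed.

(** The value of [sqsum] on a chain of ideals with [r i] members of size [i], hence its maximum for
    these sizes. *)
Definition sqmax (r : nat -> nat) : nat :=
  \sum_(i < p.+1) r i * \sum_(j < p.+1) r j * minn i j.

Lemma sqmaxE m : sqmax (rk m) = \sum_i m i * \sum_j m j * minn (isize i) (isize j).
Proof.
rewrite -[LHS](sum_rk m (fun i => \sum_(j < p.+1) rk m j * minn i j)).
by apply: eq_bigr => i _; rewrite (sum_rk m (minn (isize i))).
Qed.

Lemma cardI_le i j : #|iset i :&: iset j| <= minn (isize i) (isize j).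
Proof. by rewrite leq_min !subset_leq_card ?subsetIl ?subsetIr. Qed.

Lemma sqsum_le m : sqsum (tau m) <= sqmax (rk m).
Proof.
rewrite sqsum_tau sqmaxE; apply: leq_sum => i _; rewrite leq_mul2l.
by apply/orP; right; apply: leq_sum => j _; rewrite leq_mul2l cardI_le orbT.
Qed.

Lemma ltn_sum (I : finType) (F G : I -> nat) x :
  (forall y, F y <= G y) -> F x < G x -> \sum_y F y < \sum_y G y.
Proof.
move=> FG Fx; rewrite (bigD1 x) //= [X in _ < X](bigD1 x) //= -addSn.
by apply: leq_add => //; apply: leq_sum.
Qed.

Lemma sqsum_lt (m : 'X_{1..n}) i j : m i != 0 -> m j != 0 ->
    ~~ (iset i \subset iset j) -> ~~ (iset j \subset iset i) ->
  sqsum (tau m) < sqmax (rk m).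
Proof.
move=> mi mj ij ji; rewrite sqsum_tau sqmaxE.
have cI : #|iset i :&: iset j| < minn (isize i) (isize j).
  rewrite leq_min; apply/andP; split; apply: proper_card.
    rewrite properE subsetIl; apply: contra ij => /subset_trans; apply.
    exact: subsetIr.
  rewrite properE subsetIr; apply: contra ji => /subset_trans; apply.
  exact: subsetIl.
apply: (@ltn_sum _ _ _ i) => [x|].
  by rewrite leq_mul2l leq_sum ?orbT // => y _; rewrite leq_mul2l cardI_le orbT.
rewrite ltn_pmul2l ?lt0n //; apply: (@ltn_sum _ _ _ j) => [y|].
  by rewrite leq_mul2l cardI_le orbT.
by rewrite ltn_pmul2l ?lt0n.
Qed.

Definition onflag (w : lext T) (m : 'X_{1..n}) : Prop :=
  forall j, m j != 0 -> iset j = flag w (isize j).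

Lemma sqsum_flag w m : onflag w m -> sqsum (tau m) = sqmax (rk m).
Proof.
move=> mw; rewrite sqsum_tau sqmaxE; apply: eq_bigr => i _.
have [->//|mi] := eqVneq (m i) 0; congr (_ * _); apply: eq_bigr => j _.
have [->//|mj] := eqVneq (m j) 0; congr (_ * _).
rewrite (mw i mi) (mw j mj); wlog le : i j mi mj / isize i <= isize j.
  move=> H; case/orP: (leq_total (isize i) (isize j)) => ij; first exact: H.
  by rewrite setIC minnC H.
rewrite (setIidPl (flagS w le)) (minn_idPl le) card_flag // -ltnS.
exact: isize_le.
Qed.

Lemma lwsum_flag w m : onflag w m ->
  lwsum (tau m) = \sum_(i < p.+1) rk m i * \sum_(x in flag w i) lweight x.
Proof.
move=> mw; rewrite lwsum_tau -[RHS](sum_rk m (fun i => \sum_(x in flag w i) lweight x)).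
apply: eq_bigr => j _; have [->//|mj] := eqVneq (m j) 0.
by rewrite -(mw j mj).
Qed.

(* Between two descents [w] lists its block by increasing label, so an initial
   segment of the block has the largest weight among subsets of its size. *)
Lemma lweight_flag w (A : {set T}) :
    (forall i, des w i -> (A \subset flag w i) || (flag w i \subset A)) ->
    A != flag w #|A| ->
  \sum_(x in A) lweight x < \sum_(x in flag w #|A|) lweight x.
Proof.
move=> Ad AI; set I := flag w #|A|.
have cI : #|I| = #|A| by rewrite card_flag // max_card.
have lt x y : x \in I :\: A -> y \in A :\: I -> lweight y < lweight x.
  rewrite !inE -leqNgt => /andP [xA xI] /andP [yI yA].
  apply/lweight_lt/(@label_asc _ _ w); first exact: leq_trans yI.
  move=> i /andP [xi iy]; apply/negP => /Ad /orP [/subsetP/(_ y yA)|/subsetP/(_ x)].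
    by rewrite inE ltnNge iy.
  by rewrite inE xi (negPf xA) => /(_ isT).
rewrite (big_setID I) [X in _ < X](big_setID A) /=.
rewrite [A :&: I]setIC ltn_add2l.
have cD : #|I :\: A| = #|A :\: I|.
  by apply/eqP; rewrite -(eqn_add2l #|A :&: I|) {1}setIC !cardsID cI.
have [y yAI] : exists y, y \in A :\: I.
  apply/set0Pn; apply: contraNneq AI => E; rewrite eqEcard -/I cI leqnn andbT.
  by rewrite -setD_eq0 E.
pose M := \max_(z in A :\: I) lweight z.
apply: (@leq_ltn_trans (#|A :\: I| * M)).
  rewrite -sum_nat_const; apply: leq_sum => z zAI.
  exact: (leq_bigmax_cond (F := lweight)).
apply: (@leq_trans (#|I :\: A| * M.+1)).
  by rewrite cD ltn_pmul2l //; apply/card_gt0P; exists y.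
rewrite -sum_nat_const; apply: leq_sum => x xIA.
have x0 : 0 < lweight x by apply: leq_ltn_trans (lt _ _ xIA yAI).
rewrite -(prednK x0) ltnS; apply/bigmax_leqP => z zAI.
by rewrite -ltnS prednK // lt.
Qed.

Definition dmon (w : lext T) : 'X_{1..n} :=
  (\sum_(i < p.+1) U_(enum_rank (iflag w i)) *+ des w i)%MM.

Definition fmon (w : lext T) (a : 'X_{1..p.+1}) : 'X_{1..n} :=
  (\sum_(i < p.+1) U_(enum_rank (iflag w i)) *+ (a i + des w i))%MM.

Lemma isize_flag w (i : 'I_p.+1) : isize (enum_rank (iflag w i)) = i.
Proof. by rewrite /isize iset_rank /= card_flag // -ltnS. Qed.

Lemma rk_sum w (c : 'I_p.+1 -> nat) (i : 'I_p.+1) :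
  rk (\sum_(j < p.+1) U_(enum_rank (iflag w j)) *+ c j)%MM i = c i.
Proof.
rewrite (big_morph (rk^~ i) (fun m m' => rkD m m' i) (rk0 i)) (bigD1 i) //=.
rewrite rkMn rkU isize_flag eqxx mul1n big1 ?addn0 // => j ji.
by rewrite rkMn rkU isize_flag val_eqE (negPf ji).
Qed.

Lemma rk_fmon w a (i : 'I_p.+1) : rk (fmon w a) i = a i + des w i.
Proof. exact: rk_sum. Qed.

Lemma rk_dmon w (i : 'I_p.+1) : rk (dmon w) i = des w i.
Proof. exact: rk_sum. Qed.

Lemma fmon_onflag w a : onflag w (fmon w a).
Proof.
move=> j; rewrite /fmon mnm_sumE sum_nat_eq0 negb_forall => /existsP [i].
rewrite implyTb mulmnE mnm1E; case: (_ =P j) => // <- _.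
by rewrite isize_flag iset_rank.
Qed.

Lemma mdeg_dmon w : mdeg (dmon w) = ndes w.
Proof. by rewrite mdeg_rk /ndes; apply: eq_bigr => i _; rewrite rk_dmon. Qed.

(* The monomials other than [fmon w a] in the expansion of a product of sums over
   ideals of given sizes with [dmon w]. *)
Definition lower (w : lext T) (a : 'X_{1..p.+1}) (m : 'X_{1..n}) : Prop :=
  [/\ forall i : 'I_p.+1, rk m i = a i + des w i, (dmon w <= m)%MM &
      exists2 j, m j != 0 & iset j != flag w (isize j)].

Lemma lower_tdeg w a m : lower w a m -> tdeg (tau m) = tdeg (tau (fmon w a)).
Proof.
case=> mr _ _; rewrite /tdeg !ev_tau_None !mdeg_rk.
by apply: eq_bigr => i _; rewrite mr rk_fmon.
Qed.

(** Two incomparable factors lower [sqsum], which outweighs any gain in [lwsum]. Otherwise the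
    factors form a chain; as [dmon w] divides [m], all are comparable with the descent ideals of
    [w], so [lweight_flag] bounds the weight of each, strictly for the one off the flag. *)
Lemma lower_Phi w a m : lower w a m -> Phi (tau m) < Phi (tau (fmon w a)).
Proof.
move=> mlow; have [mr md [j mj jw]] := mlow.
rewrite /Phi (lower_tdeg mlow).
have rkE : sqmax (rk m) = sqmax (rk (fmon w a)).
  by apply: eq_bigr => i _; rewrite mr rk_fmon; congr (_ * _);
    apply: eq_bigr => i' _; rewrite mr rk_fmon.
rewrite (sqsum_flag (@fmon_onflag w a)) -rkE.
have [/existsP [i /existsP [i' /and4P [mi mi' ii' i'i]]]|chain] :=
  boolP [exists i, exists i', [&& m i != 0, m i' != 0,
    ~~ (iset i \subset iset i') & ~~ (iset i' \subset iset i)]].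
  have lt := sqsum_lt mi mi' ii' i'i; apply: leq_trans (leq_addr _ _).
  apply: leq_trans (leq_mul lt (leqnn _)); rewrite mulSn addnC ltn_add2r ltnS.
  by rewrite -(lower_tdeg mlow) lwsum_le.
have mle i i' : m i != 0 -> m i' != 0 ->
    (iset i \subset iset i') || (iset i' \subset iset i).
  move=> mi mi'; apply: contraNT chain; rewrite negb_or => /andP [h1 h2].
  by apply/existsP; exists i; apply/existsP; exists i'; rewrite mi mi' h1 h2.
rewrite -addnS; apply: leq_add; first by rewrite leq_mul2r sqsum_le orbT.
rewrite (lwsum_flag (@fmon_onflag w a)).
rewrite (eq_bigr (fun i : 'I_p.+1 => rk m i * \sum_(x in flag w i) lweight x)); last first.
  by move=> i _; rewrite mr rk_fmon.
rewrite -[X in _ < X](sum_rk m (fun i => \sum_(x in flag w i) lweight x)) lwsum_tau.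
have mdes i : des w i -> exists2 i', m i' != 0 & iset i' = flag w i.
  move=> di; have ip : i < p.+1.
    case/existsP: di => x /existsP [y /and3P [_ /eqP <- _]].
    by rewrite ltnS ltnW // pos_ltp.
  exists (enum_rank (iflag w i)); last by rewrite iset_rank.
  have /mnm_lepP/(_ (enum_rank (iflag w i))) := md; rewrite -lt0n; apply: leq_trans.
  rewrite /dmon mnm_sumE (bigD1 (Ordinal ip)) //= mulmnE mnm1E eqxx di.
  by rewrite addn_gt0.
have lw i : m i != 0 -> iset i != flag w (isize i) ->
    \sum_(x in iset i) lweight x < \sum_(x in flag w (isize i)) lweight x.
  move=> mi; apply: lweight_flag => i' /mdes [j' mj' <-]; exact: mle.
rewrite (bigD1 j) //= [X in _ < X](bigD1 j) //= -addSn; apply: leq_add.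
  by rewrite ltn_pmul2l ?lt0n // lw.
apply: leq_sum => i _; rewrite leq_mul2l; case: eqP => //= /eqP mi.
by have [<-|/(lw _ mi)/ltnW] := eqVneq (iset i) (flag w (isize i)).
Qed.

End Potential.

(** * A basis over the polynomial ring in the rank sums *)

Section FlagMonomials.
Context (disp : Order.disp_t) (T : finPOrderType disp).
Local Notation n := #|{: ideal T}|.
Local Notation k := #|{: option T}|.
Local Notation p := #|T|.

Lemma ev_fmon (w : lext T) a x : ev (tau (fmon w a)) (Some x) =
  \sum_(i < p.+1) (a i + des w i) * (pos w x < i).
Proof.
rewrite ev_tau (eq_bigr (fun j => fmon w a j * (pos w x < isize j))) => [|j _].
  rewrite (sum_rk _ (fun i => (pos w x < i) : nat)); apply: eq_bigr => i _.
  by rewrite rk_fmon.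
rewrite -/(iset j) mulnC; have [->//|/fmon_onflag ->] := eqVneq (fmon w a j) 0.
by rewrite inE.
Qed.

(** The exponent of [x] counts the factors containing [x]. At a descent between [x] and [y] the
    monomial has a factor containing [x] but not [y], so equal exponents leave only ascents in
    between. *)
Lemma ev_fmon_order (w : lext T) a x y : pos w x < pos w y ->
  let u := ev (tau (fmon w a)) in
  u (Some y) <= u (Some x) /\ (u (Some y) = u (Some x) -> label x < label y).
Proof.
move=> xy u; have le (i : 'I_p.+1) : (a i + des w i) * (pos w y < i) <=
    (a i + des w i) * (pos w x < i).
  rewrite leq_mul2l; apply/orP; right.
  by case: (ltnP (pos w y) i) => // yi; rewrite (ltn_trans xy yi).
rewrite /u !ev_fmon; split=> [|E]; first exact: leq_sum.
apply: (label_asc xy) => i /andP [xi iy]; apply/negP => di.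
have ip : i < p.+1 by rewrite ltnS ltnW // (leq_ltn_trans iy) // pos_ltp.
suff : \sum_(i < p.+1) (a i + des w i) * (pos w y < i) <
       \sum_(i < p.+1) (a i + des w i) * (pos w x < i) by rewrite E ltnn.
apply: (@ltn_sum _ _ _ (Ordinal ip)) => //=.
by rewrite xi [pos w y < i]ltnNge iy muln0 muln1 di addn1.
Qed.

Lemma sum_tail (c : nat -> nat) j : j < p ->
  \sum_(i < p.+1) c i * (j < i) = c j.+1 + \sum_(i < p.+1) c i * (j.+1 < i).
Proof.
move=> jp; have jp1 : j.+1 < p.+1 by [].
have -> : c j.+1 = \sum_(i < p.+1) c i * (i == Ordinal jp1).
  rewrite (bigD1 (Ordinal jp1)) //= eqxx muln1 big1 ?addn0 // => i /negPf ->.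
  by rewrite muln0.
rewrite -big_split; apply: eq_bigr => i _ /=; rewrite -mulnDr -val_eqE /=.
by rewrite [j < i]leq_eqVlt [i == _ :> nat]eq_sym; case: (j.+1 =P i) => // <-; rewrite ltnn.
Qed.

(* The exponents of a flag monomial decrease along [w], and strictly at descents, so
   sorting by decreasing exponent and then by increasing label recovers [w]. *)
Lemma tau_fmon_inj (w w' : lext T) a a' :
  tau (fmon w a) = tau (fmon w' a') -> w = w' /\ a = a'.
Proof.
move=> E; have Eev y : ev (tau (fmon w a)) y = ev (tau (fmon w' a')) y by rewrite E.
have ww' : w = w'.
  apply: lext_eq => x y xy; rewrite ltnNge leq_eqVlt; apply/negP.
  case/orP => [/eqP/pos_inj yx|yx]; first by rewrite yx ltnn in xy.
  have [h1 h2] := ev_fmon_order a xy; have [h3 h4] := ev_fmon_order a' yx.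
  rewrite -!Eev in h3 h4; have e : ev (tau (fmon w a)) (Some y) = ev (tau (fmon w a)) (Some x).
    by apply/eqP; rewrite eqn_leq h1 h3.
  by have := ltn_trans (h2 e) (h4 (esym e)); rewrite ltnn.
split=> //; subst w'.
pose ext (b : 'X_{1..p.+1}) (i : nat) := (if insub i is Some i' then b i' else 0) + des w i.
have extE b (i : 'I_p.+1) : ext b i = b i + des w i by rewrite /ext valK.
pose tl b j := \sum_(i < p.+1) ext b i * (j < i).
have tlE x b : ev (tau (fmon w b)) (Some x) = tl b (pos w x).
  by rewrite ev_fmon; apply: eq_bigr => i _; rewrite extE.
have tlp b : tl b p = 0.
  by rewrite /tl big1 // => i _; rewrite ltnNge -ltnS ltn_ord muln0.
have tl_eq j : j <= p -> tl a j = tl a' j.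
  rewrite leq_eqVlt => /orP [/eqP ->|/(pos_surj w) [x <-]]; first by rewrite !tlp.
  by rewrite -!tlE.
apply/mnmP => i; apply/eqP; rewrite -(eqn_add2r (des w i)) -!extE; apply/eqP.
case: i => -[|i] ip /=; last first.
  apply/eqP; rewrite -(eqn_add2r (tl a i.+1)) {2}tl_eq // /tl -!sum_tail //.
  by apply/eqP/tl_eq; apply: ltnW.
(* The empty ideal contributes to no exponent of P; its multiplicity is recovered from the total
   degree. *)
have tot b : ext b 0 + tl b 0 = mdeg (fmon w b).
  rewrite mdeg_rk big_ord_recl /tl big_ord_recl /= muln0 add0n.
  rewrite (rk_fmon w b ord0) -extE /=; congr (_ + _); apply: eq_bigr => j _.
  by rewrite muln1; exact: (etrans (extE b (lift ord0 j)) (esym (rk_fmon w b (lift ord0 j)))).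
apply/eqP; rewrite -(eqn_add2r (tl a 0)) {2}tl_eq // !tot -!ev_tau_None.
by rewrite Eev.
Qed.

Lemma sum_ltn d u : u <= d -> \sum_(j < d) (j < u) = u.
Proof.
elim: d u => [|d IH] u; first by rewrite leqn0 big_ord0 => /eqP ->.
rewrite leq_eqVlt big_ord_recr /= => /orP [/eqP ->|ud].
  rewrite ltnSn (eq_bigr (fun=> 1)) ?sum_nat_const ?card_ord ?muln1 ?addn1 // => j _.
  by rewrite ltnS ltnW.
by rewrite IH // [d < u]ltnNge -ltnS ud addn0.
Qed.

(** The level sets [L j] of the exponent function are initial segments of the sorted order [w], and
    their product has image [tau m]; empty level sets supply the missing degree. A descent of [w]
    forces a strict drop of the exponent, so its ideal is among the level sets and [c i - des w i]
    does not truncate. *)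
Lemma tau_fmon_surj (m : 'X_{1..n}) :
  exists (w : lext T) (a : 'X_{1..p.+1}), tau (fmon w a) = tau m.
Proof.
pose u x := ev (tau m) (Some x); pose d := mdeg m.
have ud x : u x <= d.
  rewrite /u /d ev_tau mdegE; apply: leq_sum => j _; case: (_ \in _) => //.
  by rewrite mul1n.
have uo x y : (y <= x)%O -> u x <= u y.
  move=> yx; rewrite /u !ev_tau; apply: leq_sum => j _; rewrite leq_mul2r.
  apply/orP; right; case: (boolP (x \in _)) => // /(ideal_le yx) -> //.
pose C := \max_(x : T) label x; have labC (x : T) : label x < C.+1 by rewrite ltnS; apply: leq_bigmax.
pose key x := (d - u x) * C.+1 + label x.
have key_lt x y : u y < u x -> key x < key y.
  move=> yx; apply: leq_trans (leq_addr _ _).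
  apply: (@leq_trans ((d - u x).+1 * C.+1)).
    by rewrite /key mulSn addnC ltn_add2r.
  by rewrite leq_mul2r ltn_sub2l ?orbT // (leq_trans yx).
have key_le x y : key x < key y -> u y <= u x.
  by move=> xy; rewrite leqNgt; apply/negP => /key_lt /(ltn_trans xy); rewrite ltnn.
have key_eq x y : u x = u y -> (key x < key y) = (label x < label y).
  by move=> xy; rewrite /key xy ltn_add2l.
have ki : injective key.
  move=> x y xy; apply: label_inj; move: (xy); rewrite /key.
  have -> : u x = u y; last by move/addnI.
  by apply/eqP; rewrite eqn_leq; apply/andP; split; rewrite leqNgt; apply/negP => /key_lt;
    rewrite xy ltnn.
have [x y xy|w wk] := lext_of_key ki.
  have := uo _ _ (ltW xy); rewrite leq_eqVlt => /orP [/eqP E|/key_lt //].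
  by rewrite key_eq // label_lt.
pose L j := [set x | j < u x].
have LE j : L j = flag w #|L j|.
  apply: flag_initial => x y; rewrite !inE wk => jx /key_le; exact: leq_trans.
pose c i := \sum_(j < d) (#|L j| == i).
have cdes i : des w i -> 0 < c i.
  case/existsP => x /existsP [y /and3P [/eqP xi /eqP yi yx]].
  have kxy : key x < key y by rewrite -wk yi -xi.
  have uxy : u y < u x.
    rewrite ltn_neqAle key_le // andbT; apply/eqP => E.
    by move: kxy; rewrite key_eq // ltnNge ltnW.
  have yd : u y < d := leq_trans uxy (ud x).
  rewrite /c (bigD1 (Ordinal yd)) //=.
  have -> : #|L (u y)| = i; last by rewrite eqxx.
  apply/eqP; rewrite eqn_leq; apply/andP; split.
    by rewrite -yi leqNgt; have := LE (u y) => /setP/(_ y); rewrite !inE ltnn => <-.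
  by rewrite -xi; have := LE (u y) => /setP/(_ x); rewrite !inE uxy => <-.
exists w, [multinom c i - des w i | i < p.+1].
have aE (i : 'I_p.+1) : [multinom c i - des w i | i < p.+1]%MM i + des w i = c i.
  by rewrite mnmE subnK //; case: (boolP (des w i)) => // /cdes.
have sumc (G : nat -> nat) : \sum_(i < p.+1) c i * G i = \sum_(j < d) G #|L j|.
  rewrite (eq_bigr (fun i : 'I_p.+1 => \sum_(j < d) (#|L j| == i) * G i)); last first.
    by move=> i _; rewrite /c big_distrl.
  rewrite exchange_big; apply: eq_bigr => j _.
  have jp : #|L j| < p.+1 by rewrite ltnS max_card.
  rewrite (bigD1 (Ordinal jp)) //= eqxx mul1n big1 ?addn0 // => i.
  by rewrite -val_eqE /= eq_sym => /negPf ->.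
apply: ev_inj => -[x|]; last first.
  rewrite !ev_tau_None mdeg_rk -/d (eq_bigr (fun i : 'I_p.+1 => c i * 1)); last first.
    by move=> i _; rewrite rk_fmon aE muln1.
  by rewrite (sumc (fun=> 1)) sum_nat_const card_ord muln1.
rewrite ev_fmon (eq_bigr (fun i : 'I_p.+1 => c i * (pos w x < i))); last first.
  by move=> i _; rewrite aE.
rewrite (sumc (fun i => (pos w x < i) : nat)) -/(u x) -[RHS](sum_ltn (ud x)).
by apply: eq_bigr => j _; have /setP/(_ x) := LE j; rewrite !inE => <-.
Qed.

End FlagMonomials.

Local Open Scope ring_scope.

Section Basis.
Context (K : fieldType) (disp : Order.disp_t) (T : finPOrderType disp).
Local Notation n := #|{: ideal T}|.
Local Notation k := #|{: option T}|.
Local Notation p := #|T|.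
Local Notation S := {mpoly K[n]}.
Local Notation U := {mpoly K[k]}.
Local Notation A := {mpoly K[p.+1]}.
Local Notation toric := (@toric K disp T).

Definition theta (i : nat) : S := \sum_(j < n | isize j == i) 'X_j.

Definition Theta : {rmorphism A -> S} := subst_mpoly (fun i : 'I_p.+1 => theta i).

Lemma mcoeffXM_neq0 N (q : {mpoly K[N]}) (v m : 'X_{1..N}) :
  ('X_[v] * q)@_m != 0 -> exists2 m', m = (v + m')%MM & q@_m' != 0.
Proof.
rewrite mulrC -mcoeff_msupp (perm_mem (msuppMX _ _)) => /mapP [m' m'q ->].
by exists m' => //; rewrite -mcoeff_msupp.
Qed.

Lemma mcoeff_sum_neq0 N (I : finType) (P : pred I) (F : I -> {mpoly K[N]}) m :
  (\sum_(i | P i) F i)@_m != 0 -> exists2 i, P i & (F i)@_m != 0.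
Proof.
move=> Fm; apply/exists_inP; apply: contraNT Fm => /exists_inPn F0.
by rewrite raddf_sum /= big1 // => i /F0 /negbNE/eqP.
Qed.

(** Induction on the degree of [a]: a further factor [theta i] either contributes the flag ideal of
    size [i] or leaves the flag, and a monomial that has left the flag stays [lower] after
    multiplication. *)
Lemma Theta_dmon (w : lext T) a : exists2 g : S,
  Theta 'X_[a] * 'X_[dmon w] = 'X_[fmon w a] + g &
  forall m, g@_m != 0 -> lower w a m.
Proof.
have [d] := ubnP (mdeg a); elim: d a => // d IH a; rewrite ltnS => ad.
have [a0|] := eqVneq (mdeg a) 0%N.
  move/eqP: a0; rewrite mdeg_eq0 => /eqP ->; exists 0 => [|m]; last by rewrite mcoeff0 eqxx.
  rewrite mpolyX0 rmorph1 mul1r addr0; congr 'X_[_]; apply: eq_bigr => i _.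
  by rewrite mnm0E.
rewrite mdegE sum_nat_eq0 negb_forall => /existsP [i]; rewrite implyTb => ai.
pose a' := (a - U_(i))%MM; have aE : a = (U_(i) + a')%MM by rewrite addmC submK // lep1mP.
have [|g' gE gl] := IH a'; first by move: ad; rewrite aE mdegD mdeg1.
pose j0 := enum_rank (iflag w i).
have j0i : isize j0 == i by rewrite isize_flag.
have fE : fmon w a = (U_(j0) + fmon w a')%MM.
  rewrite /fmon aE (bigD1 i) //= [in RHS](bigD1 i) //= addmA; congr (_ + _)%MM.
    by rewrite mnmDE mnm1E eqxx -addnA mulmS.
  by apply: eq_bigr => i' ii'; rewrite mnmDE mnm1E eq_sym (negPf ii').
have low j m : isize j == i -> (forall i' : 'I_p.+1, rk m i' = a' i' + des w i')%N ->
   (dmon w <= m)%MM -> (exists2 j', (U_(j) + m)%MM j' != 0%N & iset j' != flag w (isize j')) ->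
   lower w a (U_(j) + m).
  move=> ji mr md mj; split=> // [i'|].
    by rewrite rkD rkU mr aE mnmDE mnm1E (eqP ji) addnA val_eqE.
  by apply: lepm_trans md (lem_addl _ _).
pose g1 : S := \sum_(j < n | (isize j == i) && (j != j0)) 'X_j * 'X_[fmon w a'].
exists (g1 + theta i * g').
  have ThU : Theta 'X_i = theta i := subst_mpolyXU _ _.
  rewrite aE mpolyXD rmorphM -mulrA gE ThU mulrDr addrA; congr (_ + _).
  by rewrite /theta mulr_suml (bigD1 j0) //= -mpolyXD -aE fE.
move=> m; rewrite mcoeffD; have [->|m1 _] := eqVneq (g1@_m) 0.
  rewrite add0r /theta mulr_suml => /mcoeff_sum_neq0 [j ji] /mcoeffXM_neq0 [m' -> m'g].
  have [mr md [j' j'1 j'2]] := gl _ m'g; apply: low => //; exists j' => //.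
  by rewrite mnmDE addn_eq0 negb_and j'1 orbT.
have [j /andP [ji jj0] /mcoeffXM_neq0 [m' ->]] := mcoeff_sum_neq0 m1.
rewrite mcoeffX; case: (_ =P m') => [<- _|_]; last by rewrite eqxx.
apply: low => // [i'||]; first exact: rk_fmon.
  apply/mnm_lepP => j'; rewrite /dmon /fmon !mnm_sumE; apply: leq_sum => i' _.
  by rewrite !mulmnE leq_mul2l leq_addl orbT.
exists j; first by rewrite mnmDE mnm1E eqxx.
apply: contra jj0; rewrite (eqP ji) /j0 => /eqP E; apply/eqP.
by rewrite -[j]enum_valK; congr enum_rank; apply: val_inj.
Qed.

Lemma toric_coef (q : S) u : (toric q)@_u != 0 -> exists2 m, q@_m != 0 & tau m = u.
Proof.
rewrite {1}[q]mpolyE rmorph_sum raddf_sum /=; case: (pickP (fun i : 'I_(size (msupp q)) =>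
    tau (nth 0%MM (msupp q) i) == u)) => [i /eqP iu _|nu].
  by exists (nth 0%MM (msupp q) i); rewrite // -mcoeff_msupp mem_nth.
rewrite big_seq big1 ?eqxx // => m mq.
rewrite toricZ mcoeffZ toricX mcoeffX.
have lt : (index m (msupp q) < size (msupp q))%N by rewrite index_mem.
by have := nu (Ordinal lt); rewrite /= nth_index // => ->; rewrite mulr0.
Qed.

Definition bmon (w : lext T) a : U := toric (Theta 'X_[a]) * toric 'X_[dmon w].

(** Triangularity: all other monomials of [bmon w a] have smaller potential than its leading one,
    and leading monomials of different pairs differ by [tau_fmon_inj]. *)
Lemma bmon_coef w a w0 a0 :
    (Phi (tau (fmon w a)) <= Phi (tau (fmon w0 a0)))%N ->
  (bmon w a)@_(tau (fmon w0 a0)) = ((w == w0) && (a == a0))%:R.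
Proof.
move=> le; rewrite /bmon -rmorphM; have [g -> gl] := Theta_dmon w a.
rewrite rmorphD toricX mcoeffD mcoeffX [X in _ + X](_ : _ = 0) ?addr0.
  case: eqP => [/tau_fmon_inj [-> ->]|ne]; first by rewrite !eqxx.
  by case: eqP => // ww; case: eqP => // aa; case: ne; rewrite ww aa.
apply/eqP; apply: contraTT le => /toric_coef [m gm mu].
by rewrite -ltnNge -mu; apply: lower_Phi; apply: gl.
Qed.

Lemma basis_sum (v : lext T -> A) :
  \sum_w toric (Theta (v w)) * toric 'X_[dmon w] =
  \sum_w \sum_(a <- msupp (v w)) (v w)@_a *: bmon w a.
Proof.
apply: eq_bigr => w _; rewrite {1}[v w]mpolyE (rmorph_sum Theta) (rmorph_sum toric) mulr_suml.
apply: eq_bigr => a _; rewrite /bmon -[X in Theta X]mul_mpolyC !rmorphM.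
rewrite [Theta _%:MP]subst_mpolyC [toric _%:MP]subst_mpolyC mul_mpolyC.
by rewrite scalerAl.
Qed.

Lemma basis_free (v : lext T -> A) :
  \sum_w toric (Theta (v w)) * toric 'X_[dmon w] = 0 -> forall w, v w = 0.
Proof.
rewrite basis_sum => v0 w; apply/eqP; apply: contraT => vw.
(* The relation is read at a leading monomial of maximal potential, where only one product
   contributes. *)
pose P N := [exists w, has (fun a => Phi (tau (fmon w a)) == N) (msupp (v w))].
have exP : exists N, P N.
  exists (Phi (tau (fmon w (mlead (v w))))); apply/existsP; exists w.
  by apply/hasP; exists (mlead (v w)); rewrite ?mlead_supp.
pose b := (\sum_w \sum_(a <- msupp (v w)) Phi (tau (fmon w a)))%N.
have bP N : P N -> (N <= b)%N.
  case/existsP => w' /hasP [a av /eqP <-]; rewrite /b (bigD1 w') //=.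
  by rewrite (bigD1_seq a) ?msupp_uniq //= -addnA leq_addr.
case: (ex_maxnP exP bP) => N /existsP [w0 /hasP [a0 a0v /eqP N0]] Nmax.
have /eqP := congr1 (mcoeff (tau (fmon w0 a0))) v0.
pose c w a := (bmon w a)@_(tau (fmon w0 a0)).
have sumE : (\sum_w \sum_(a <- msupp (v w)) (v w)@_a *: bmon w a)@_(tau (fmon w0 a0)) =
    \sum_w \sum_(a <- msupp (v w)) (v w)@_a * c w a.
  rewrite raddf_sum; apply: eq_bigr => w' _; rewrite raddf_sum.
  by apply: eq_bigr => a _; exact: mcoeffZ.
have cE w' a : a \in msupp (v w') -> c w' a = ((w' == w0) && (a == a0))%:R.
  move=> av; apply: bmon_coef; rewrite N0; apply: Nmax.
  by apply/existsP; exists w'; apply/hasP; exists a.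
rewrite sumE mcoeff0 (bigD1 w0) //= [X in _ + X]big1 ?addr0 => [|w' w'0]; last first.
  by rewrite big_seq big1 // => a av; rewrite cE // (negPf w'0) mulr0.
rewrite (bigD1_seq a0) ?msupp_uniq //= cE // !eqxx mulr1.
rewrite big_seq_cond big1 ?addr0 => [|a /andP [av aa0]].
  by move: a0v; rewrite mcoeff_msupp => /negPf ->.
by rewrite cE // (negPf aa0) andbF mulr0.
Qed.

Lemma basis_span (s : S) : exists v : lext T -> A,
  toric s = \sum_w toric (Theta (v w)) * toric 'X_[dmon w].
Proof.
pose sp (q : S) := exists v : lext T -> A,
  toric q = \sum_w toric (Theta (v w)) * toric 'X_[dmon w].
have spD q r : sp q -> sp r -> sp (q + r).
  move=> [v vE] [v' v'E]; exists (fun w => v w + v' w); rewrite rmorphD vE v'E.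
  by rewrite -big_split; apply: eq_bigr => w _; rewrite !rmorphD mulrDl.
have spC (c : K) q : sp q -> sp (c *: q).
  move=> [v vE]; exists (fun w => c%:MP * v w).
  rewrite -mul_mpolyC rmorphM vE mulr_sumr; apply: eq_bigr => w _.
  rewrite !rmorphM [Theta _%:MP]subst_mpolyC mulrA //.
have sp0 : sp 0.
  by exists (fun=> 0); rewrite rmorph0 big1 // => w _; rewrite !rmorph0 mul0r.
have spM q : (forall m, q@_m != 0 -> sp 'X_[m]) -> sp q.
  move=> qm; rewrite [q]mpolyE; rewrite big_seq; elim/big_ind: _ => //= m mq.
  by apply/spC/qm; rewrite -mcoeff_msupp.
apply: (spM) => m _; have [N] := ubnP (Phi (tau m)).
elim: N m => // N IH m; rewrite ltnS => mN.
(* Only the toric image matters, so [m] may be traded for a flag monomial; the remaining terms [g]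
   have smaller potential and fall under the induction hypothesis. *)
have [w [a wa]] := tau_fmon_surj m; have [g gE gl] := Theta_dmon w a.
have [v vE] : sp (Theta 'X_[a] * 'X_[dmon w] - g).
  apply: spD.
    exists (fun w' => if w' == w then 'X_[a] else 0); rewrite rmorphM.
    rewrite (bigD1 w) //= eqxx big1 ?addr0 // => w' /negPf ->.
    by rewrite !rmorph0 mul0r.
  rewrite -scaleN1r; apply/spC/spM => m' /gl /lower_Phi; rewrite wa => lt.
  by apply: IH; apply: leq_trans mN.
exists v; rewrite -vE gE addrK.
by rewrite (toricX K (fmon w a)) wa -toricX.
Qed.

Definition base_bcx : bcx K p.+1 k :=
  @Bcx K p.+1 k (lext T) (fun=> 0%N) (@ndes _ T) (fun _ _ => 0)
    (fun w => toric 'X_[dmon w]).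

(** The morphism is abstract because the tower starts from a single substitution, which agrees with
    this composite only pointwise. *)
Lemma base_res (f : {rmorphism A -> U}) : (forall s, f s = toric (Theta s)) ->
  is_res (@tdeg _ T) f (fun u => exists s, u = toric s) base_bcx.
Proof.
move=> fE; split=> //=.
- by move=> a b; rewrite eqxx.
- by move=> a b; rewrite eqxx.
- by move=> w; apply: toric_homog; rewrite dhomogX /= mdeg_dmon.
- by move=> a c; rewrite /bd big1 // => b _; rewrite mul0r.
- by move=> a; rewrite /av big1 // => b _; rewrite rmorph0 mul0r.
- move=> v _ va; exists (fun=> 0) => c; rewrite /bd big1 => [|b _]; last exact: mul0r.
  apply: basis_free; rewrite -[RHS]va; apply: eq_bigr => w _; by rewrite fE.
- move=> u; split=> [[s ->]|[v ->]].
    have [v ->] := basis_span s; exists v; apply: eq_bigr => w _; by rewrite fE.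
  exists (\sum_w Theta (v w) * 'X_[dmon w]); rewrite rmorph_sum.
  by apply: eq_bigr => w _; rewrite fE rmorphM.
Qed.

End Basis.

(** * The resolution of the Hibi ring *)

Section HibiResolution.
Context (K : fieldType) (disp : Order.disp_t) (T : finPOrderType disp).
Local Notation n := #|{: ideal T}|.
Local Notation k := #|{: option T}|.
Local Notation p := #|T|.
Local Notation S := {mpoly K[n]}.
Local Notation U := {mpoly K[k]}.
Local Notation toric := (@toric K disp T).

(* A linear change of coordinates of [S]: in each rank the variable of the ideal
   in a fixed maximal flag is traded for [theta]. *)
Section Coordinates.
Context (w : lext T).

Definition offlag : seq 'I_n := [seq j <- enum 'I_n | iset j != flag w (isize j)].
Local Notation n' := (size offlag + p.+1)%N.

Lemma mem_offlag j : (j \in offlag) = (iset j != flag w (isize j)).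
Proof. by rewrite mem_filter mem_enum andbT. Qed.

(** The [theta] come first because the base complex lives over them and the tower adjoins variables
    at the end. The [nth] default keeps the sequence linear past its meaningful range, as the tower
    asks for every index. *)
Definition newvar (i : nat) : S :=
  if (i < p.+1)%N then theta K T i else 'X_(nth (enum_rank (iflag w 0)) offlag (i - p.+1)).

Definition var (i : nat) : {mpoly K[n']} := if insub i is Some i' then 'X_i' else 0.

Definition offvar (j : 'I_n) : {mpoly K[n']} := var (p.+1 + index j offlag).

Definition phi : {rmorphism {mpoly K[n']} -> S} :=
  subst_mpoly (fun i : 'I_n' => newvar i).

Definition psi : {rmorphism S -> {mpoly K[n']}} :=
  subst_mpoly (fun j : 'I_n => if iset j == flag w (isize j)
    then var (isize j) - \sum_(j' < n | (isize j' == isize j) && (j' != j)) offvar j'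
    else offvar j).

(** Each size has a single ideal on the flag; hence [theta] minus the off-flag variables of that
    size returns the flag variable, which is how [psi] inverts [phi]. *)
Lemma flag_uniq j j' : iset j = flag w (isize j) -> isize j' = isize j -> j' != j ->
  j' \in offlag.
Proof.
move=> jw jj' ne; rewrite mem_offlag; apply: contra ne => /eqP E; apply/eqP.
rewrite -[j]enum_valK -[j']enum_valK; congr enum_rank; apply: val_inj.
by rewrite -!/(iset _) E jw jj'.
Qed.

Lemma phi_var i : (i < n')%N -> phi (var i) = newvar i.
Proof.
move=> i_n; rewrite /var insubT; exact: (subst_mpolyXU (fun i : 'I_n' => newvar i)).
Qed.

Lemma phi_offvar j : j \in offlag -> phi (offvar j) = 'X_j.
Proof.
move=> jo; rewrite /offvar phi_var; last first.
  by rewrite addnC ltn_add2r index_mem.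
by rewrite /newvar ltnNge leq_addr /= addKn nth_index.
Qed.

Lemma psiX j : psi 'X_j = if iset j == flag w (isize j)
    then var (isize j) - \sum_(j' < n | (isize j' == isize j) && (j' != j)) offvar j'
    else offvar j.
Proof. exact: subst_mpolyXU. Qed.

Lemma psiK : cancel psi phi.
Proof.
move=> s; rewrite -[RHS]/(idfun s); change ((phi \o psi) s = idfun s).
apply: rmorph_mpoly_eq => [c|j].
  by rewrite /= [subst_mpoly _ c%:MP]subst_mpolyC [LHS]subst_mpolyC.
change (phi (psi 'X_j) = 'X_j); rewrite psiX; case: eqP => jw; last first.
  by rewrite phi_offvar // mem_offlag; apply/eqP.
rewrite rmorphB (rmorph_sum phi) phi_var; last first.
  by rewrite (leq_trans (isize_le j)) // leq_addl.
rewrite /newvar isize_le /theta (bigD1 j) //=.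
rewrite [X in _ - X](eq_bigr (fun j' => 'X_j')) ?addrK // => j' /andP [/eqP jj' ne].
by rewrite [LHS]phi_offvar // (flag_uniq jw).
Qed.

Lemma phiK : cancel phi psi.
Proof.
move=> s; change ((psi \o phi) s = idfun s).
apply: rmorph_mpoly_eq => [c|i].
  by rewrite /= [subst_mpoly _ c%:MP]subst_mpolyC [LHS]subst_mpolyC.
change (psi (phi 'X_i) = 'X_i); rewrite [phi _](subst_mpolyXU _ i) /newvar.
have varE : var i = 'X_i by rewrite /var valK.
case: ltnP => ip; last first.
  have lt : (i - p.+1 < size offlag)%N by rewrite ltn_subLR // [X in (_ < X)%N]addnC.
  set j := nth _ _ _; have jo : j \in offlag by apply: mem_nth.
  rewrite psiX; move: (jo); rewrite mem_offlag => /negPf ->.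
  have ou : uniq (offlag) by exact: filter_uniq (enum_uniq _).
  by rewrite /offvar index_uniq // subnKC.
pose j0 := enum_rank (iflag w i).
have j0i : isize j0 = i by rewrite /isize iset_rank /= card_flag.
have j0w : iset j0 = flag w (isize j0) by rewrite j0i iset_rank.
rewrite /theta (rmorph_sum psi) (bigD1 j0) ?j0i //= [psi _]psiX j0w eqxx j0i.
rewrite [X in _ + X](eq_bigr (fun j => offvar j)) ?subrK // => j /andP [/eqP ji ne].
rewrite [LHS]psiX; have := flag_uniq j0w _ ne; rewrite ji j0i => /(_ erefl).
by rewrite mem_offlag ji => /negPf ->.
Qed.

Lemma newvar_homog i : newvar i \is 1.-homog.
Proof.
rewrite /newvar; case: ifP => _; last by rewrite dhomogX /= mdeg1.
by apply: rpred_sum => j _; rewrite dhomogX /= mdeg1.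
Qed.

Lemma subst_newvar N (s : {mpoly K[N]}) : subst_mpoly (fun i : 'I_N => toric (newvar i)) s =
  toric (subst_mpoly (fun i : 'I_N => newvar i) s).
Proof.
change (subst_mpoly (fun i : 'I_N => toric (newvar i)) s =
  (toric \o subst_mpoly (fun i : 'I_N => newvar i)) s).
apply: rmorph_mpoly_eq => [c|i] /=.
  by rewrite !subst_mpolyC.
by rewrite !subst_mpolyXU.
Qed.

End Coordinates.

Local Notation R := (fun u : U => exists s : S, u = toric s).

Lemma hibi_res : exists (C : bcx K n k) (m r : nat), [/\ is_res (@tdeg _ T) toric R C,
    forall b, (hd C b <= m)%N /\ (dg C b <= hd C b + r)%N,
    exists b, hd C b = m /\ dg C b = (m + r)%N,
    forall w : lext T, (ndes w <= r)%N & exists w : lext T, r = ndes w].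
Proof.
have [w _] := lext_exists T.
pose r := (\max_(v : lext T) ndes v)%N.
have [v rv] : exists v : lext T, r = ndes v.
  have c0 : (0 < #|{: lext T}|)%N by apply/card_gt0P; exists w.
  by have [v] := bigop.eq_bigmax (@ndes _ T) c0; exists v.
have le (u : lext T) : (ndes u <= r)%N by apply: (bigop.leq_bigmax (F := @ndes _ T)).
pose h i := toric (newvar w i).
have hh i : h i \is 1.-homog for (@tdeg _ T) by apply/toric_homog/newvar_homog.
have RD x y : R x -> R y -> R (x + y).
  by move=> [s ->] [t ->]; exists (s + t); rewrite rmorphD.
have RM N (s : {mpoly K[N]}) x : R x -> R (subst_mpoly (fun i : 'I_N => h i) s * x).
  by move=> [t ->]; rewrite subst_newvar -rmorphM; eexists.
have Br : is_res (@tdeg _ T) (subst_mpoly (fun i : 'I_p.+1 => h i)) R (base_bcx K T).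
  apply: base_res => s; rewrite [LHS]subst_newvar; congr (toric _).
  apply: rmorph_mpoly_eq => [c|i]; rewrite ?[LHS]subst_mpolyC ?[RHS]subst_mpolyC //.
  by rewrite [LHS]subst_mpolyXU [RHS]subst_mpolyXU /newvar ltn_ord.
have [||C [Cr Cb Ce]] := tower_res hh RD RM (r := r) Br _ _ (size (offlag w)).
- by move=> b; split=> //; apply: le.
- by exists v.
exists (map_bcx (phi w) C), (size (offlag w)), r; split=> //; last by exists v.
apply: (map_bcx_res (@phiK w) (@psiK w)) Cr.
- by apply: subst_mpoly_homog => i; apply: newvar_homog.
- by move=> s; apply: subst_newvar.
Qed.

End HibiResolution.

Theorem theorem8 (K : fieldType) (disp : Order.disp_t) (T : finPOrderType disp) :
  ~ planar_lattice T ->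
  (exists F : resolution T K, is_min_graded_free_resolution F) /\
  (forall F : resolution T K, is_min_graded_free_resolution F ->
     (res_reg F <= #|T| - 1)%N /\
     (forall Q : {set T}, antichain Q -> (#|Q| - 1 <= res_reg F)%N)).
Proof.
move=> _; have [C [m [r [Cr Cb [e [eh ed]] rmax [w rw]]]]] := hibi_res K T.
pose R (u : {mpoly K[#|{: option T}|]}) := exists s, u = toric K T s.
have imf u : R u <-> exists s, u = toric K T s by [].
have th := @toric_homog K _ T; have ker := @ker_toric K _ T.
split.
  have [C' C'r C'min] := min_res_exists Cr.
  by exists (res_of_bcx C'); apply: (res_of_bcx_min th ker imf C'r C'min).
move=> F Fr; have Fres := bcx_of_res_is_res (@tdeg _ T) ker imf Fr.
have Fmin := bcx_of_res_min (k := #|{: option T}|) Fr; split=> [|Q Qa].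
  apply: leq_trans (ndes_le w); rewrite -rw.
  apply/bigmax_leqP => i _; apply/bigmax_leqP => x _.
  (* By minimality every generator of [F] has a counterpart of the same bidegree in [C], where [dg]
     is at most [hd + r]. *)
  have [b [bh bd]] := bcx_of_res_gen #|{: option T}| x (ltn_ord i : i <= _)%N.
  have [b' [b'h b'd]] := res_gen_transfer th Fres Cr (fun a => conj (Fmin b a) (Fmin a b)).
  by rewrite -bd -b'd -bh -b'h leq_subLR; case: (Cb b').
have [v Qv] := antichain_ndes Qa.
apply: leq_trans Qv (leq_trans (rmax v) _).
have [|e' [e'h e'd]] := @res_gen_transfer _ _ _ _ _ _ th C (bcx_of_res _ F) e Cr Fres.
  (* A unit entry would join generators of equal degree. The boundary of [e] lies in homological
     degree [m - 1], where degrees are at most [m - 1 + r], and no generator of degree [m + 1] can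
     map to [e]. *)
  move=> a; split; apply/eqP; apply: contraT => d0.
    have df0 : df C e a != 0 by apply: contraNneq d0 => ->; rewrite mcoeff0.
    have [_ h2] := df_homog Cr df0; have /eqP := mcoeff0_homog h2 d0.
    have := df_hd Cr df0; rewrite ed eh subn_eq0 => ->.
    by have [_ h3] := Cb a; rewrite addSn => /leq_trans /(_ h3); rewrite ltnn.
  have df0 : df C a e != 0 by apply: contraNneq d0 => ->; rewrite mcoeff0.
  by have [h3 _] := Cb a; move: h3; rewrite (df_hd Cr df0) eh ltnn.
by have := bcx_of_res_reg e'; rewrite e'h e'd eh ed addKn.
Qed.
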